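(* Fix $\eta\in(0,1)$ and $L=\log(2KT/\eta)$. Consider a blockwise group-floor bandit with $K$ arms, rewards in $[0,1]$, $B$ blocks, horizon $T=\sum_bH_b$, arbitrary (possibly overlapping) groups $\mathcal G$ and integer group floors $f_{b,g}\ge0$. Suppose that, for some $\sigma\in(0,1)$, every block satisfies the sampled-plan descent condition with margin $\sigma$ at level $\eta$, together with the block-start slack condition $\sigma H_b>2K$ for every block $b$. Then P-BDQ-UCB satisfies every group floor in every block pathwise, and its expected regret against the per-block fractional group-fair optimum satisfies $$\mathrm{OPT}^{\mathrm{frac}}-\mathbb E[V]\ \le\ K+4\sqrt{2KTL}+2\eta T+CB\Bigl(\frac{L}{\sigma^2}+\frac K\sigma\Bigr)$$ for a universal constant $C$, where $V=\sum_{\tau=1}^T\mu_{A_\tau}$. With $\eta=1/T$, the expected regret is $\widetilde O(\sqrt{KT})+\widetilde O\bigl(B(1/\sigma^2+K/\sigma)\bigr)$, where $\widetilde O$ hides factors logarithmic in $K$ and $T$.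
   Context: Bandit: arm $i\in[K]$ produces independent rewards in $[0,1]$ with mean $\mu_i$ (i.i.d. within an arm); $A_\tau$ is the arm pulled at round $\tau$; $N_i(\tau)$ and $\widehat\mu_i$ are the pull count and empirical mean of arm $i$ before round $\tau$ over all observations ($\widehat\mu_i=0$ if $N_i=0$). The horizon is partitioned into $B$ consecutive blocks, block $b$ of length $H_b$; $\mathcal G$ is a collection of nonempty subsets of $[K]$; block $b$ requires each group $g$ to receive at least $f_{b,g}$ pulls (of arms in $g$) inside the block. $\mathrm{OPT}^{\mathrm{frac}}=\sum_b\max\{\langle\mu,y\rangle:y\ge0,\ \sum_{i\in g}y_i\ge f_{b,g}\ \forall g,\ \sum_iy_i=H_b\}$. Notation. At a round $\tau$ of block $b$: $r(\tau)$ is the number of rounds remaining in the block (including $\tau$), $d_g(\tau)=\max\{f_{b,g}-\#\{\text{pulls of arms of }g\text{ so far in the block}\},0\}$. For a demand vector $d\ge0$, $\mathrm{mc}(d)=\min\{\sum_iy_i:y\ge0,\ \sum_{i\in g}y_i\ge d_g\ \forall g\in\mathcal G\}$, and $S(\tau)=r(\tau)-\mathrm{mc}(d(\tau))$. Write $d^+(A)_g=\max\{d_g-\mathbf 1\{A\in g\},0\}$ and $\Psi_\mu(r,d)=\max\{\langle\mu,y\rangle:y\ge0,\ \sum_{i\in g}y_i\ge d_g\ \forall g,\ \sum_iy_i=r\}$. Clipped indices: $U_i(\tau)=\min\{1,\widehat\mu_i+\sqrt{2L/(N_i(\tau)\vee1)}\}$. P-BDQ-UCB. In each block: at the first round $\tau$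 with $S(\tau)\le2K$ (the guard fires, at most once per block), commit to the lexicographically first minimum fractional cover $w(\tau)$ attaining $\mathrm{mc}(d(\tau))$, pull each arm $i$ exactly $\lceil w_i(\tau)\rceil$ times over the following rounds, and spend any leftover rounds of the block on the arm with maximal index. At every earlier (pre-guard) round, compute the lexicographically first extreme-point solution $\widehat y(\tau)$ of $\max\{\sum_iU_i(\tau)y_i:y\ge0,\ \sum_{i\in g}y_i\ge d_g(\tau)\ \forall g,\ \sum_iy_i=r(\tau)\}$ and draw $A_\tau$ from the distribution $p_i=\widehat y_i(\tau)/r(\tau)$. Sampled-plan descent condition with margin $\sigma$ at level $\eta$. Let $\mathcal E_L$ be the concentration event that for every arm $i$ and every $n\in\{1,\dots,T\}$ the empirical mean of the first $n$ rewards of arm $i$ is within $\sqrt{2L/n}$ of $\mu_i$; on it every index satisfies $\mu_i\le U_i(\tau)\le\mu_i+\rho_i(\tau)$ with $\rho_i(\tau)=\min\{1,2\sqrt{2L/(N_i(\tau)\vee1)}\}$. Block $b$ satisfies the condition if $H_b-\mathrm{mc}(f_b)\ge\sigma H_b$ (with $f_b=(f_{b,g})_g$) and, on $\mathcal E_L$, at every pre-guard state generated by P-BDQ-UCB in the block, with remaining budget $r$, deficits $d$, sampling distribution $p=\widehat y/r$ and radii $\rho_i$, $$\mathbb E_{A\sim p}[\mathrm{mc}(d^+(A))]\le\frac{r-1}{r}\mathrm{mc}(d),\qquad \mathbb E_{A\sim p}[\Psi_\mu(r-1,d^+(A))+\mu_A]\ge\Psi_\mu(r,d)-\mathbb E_{A\sim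 p}[\rho_A].$$ *)

(* Defs.v *)
From HB Require Import structures.
From mathcomp Require Export all_boot all_order all_algebra.
From mathcomp Require Export all_classical all_reals all_analysis.

Set Implicit Arguments.
Unset Strict Implicit.
Unset Printing Implicit Defensive.

Export Order.TTheory GRing.Theory Num.Theory.
Export numFieldNormedType.Exports.

Local Open Scope classical_set_scope.
Local Open Scope ring_scope.

Section Covering.
Context (R : realType) (K : nat) (G : {set {set 'I_K}}).

Implicit Types (d : {set 'I_K} -> R) (c : 'I_K -> R) (y : 'rV[R]_K) (r : R).

Definition total y : R := \sum_i y 0 i.

Definition value c y : R := \sum_i c i * y 0 i.

Definition covers d : set 'rV[R]_K :=
  [set y | (forall i, 0 <= y 0 i) /\
           (forall g, g \in G -> d g <= \sum_(i in g) y 0 i)].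

(* The minimum is attained as soon as no group of [G] is empty. *)
Definition mc d : R := inf [set total y | y in covers d].

Definition plans r d : set 'rV[R]_K := covers d `&` [set y | total y = r].

(* [plans r d] is compact, so that the supremum is a maximum whenever a plan
   exists, i.e. whenever [mc d <= r]; otherwise it has the junk value [0]. *)
Definition Psi c r d : R := sup [set value c y | y in plans r d].

Definition extreme_point (Q : set 'rV[R]_K) y : Prop :=
  Q y /\ forall u v (t : R), Q u -> Q v -> 0 < t < 1 ->
    y = t *: u + (1 - t) *: v -> u = y /\ v = y.

Definition lex_le (y z : 'rV[R]_K) : bool :=
  (([tuple y 0 i | i < K] : K.-tuplelexi R) <= [tuple z 0 i | i < K])%O.

Definition lex_first (S : set 'rV[R]_K) : 'rV[R]_K :=
  xget 0 [set y | S y /\ forall z, S z -> lex_le y z].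

Definition min_cover d : 'rV[R]_K :=
  lex_first [set y | covers d y /\ total y = mc d].

Definition opt_plan c r d : 'rV[R]_K :=
  lex_first [set y | extreme_point (plans r d) y /\ value c y = Psi c r d].

Definition dplus d (i : 'I_K) : {set 'I_K} -> R :=
  fun g => Num.max (d g - (i \in g)%:R) 0.

End Covering.

Record problem (R : realType) := Problem {
  narms : nat;
  nblocks : nat;
  blen : 'I_nblocks -> nat;
  groups : {set {set 'I_narms}};
  flr : 'I_nblocks -> {set 'I_narms} -> nat;
  mean : 'I_narms -> R;
  narms_gt0 : (0 < narms)%N;
  nblocks_gt0 : (0 < nblocks)%N;
  groups_neq0 : finset.set0 \notin groups }.

Section Algorithm.
Context (R : realType) (I : problem R).
Local Notation K := (narms I).
Local Notation B := (nblocks I).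

Definition horizon : nat := (\sum_b @blen _ I b)%N.

(* Rounds are numbered from 0; block [b] consists of the rounds [t] with
   [bstart b <= t < bend b]. *)
Definition bstart (b : 'I_B) : nat := (\sum_(c < B | (c < b)%N) blen c)%N.
Definition bend (b : 'I_B) : nat := (bstart b + blen b)%N.

Definition floor_demand (b : 'I_B) : {set 'I_K} -> R :=
  fun g => (flr b g)%:R.

Definition OPTfrac : R :=
  \sum_b Psi (groups I) (@mean _ I) (blen b)%:R (floor_demand b).

Definition conf_level (eta : R) : R := ln (2 * K%:R * horizon%:R / eta).

(* [a t] is the arm pulled at round [t], and [x i n] is the reward returned by
   the [n.+1]-th pull of arm [i]. *)
Implicit Types (a : nat -> 'I_K) (x : 'I_K -> nat -> R) (L : R) (t : nat).

Definition pulls a (D : {set 'I_K}) (m n : nat) : nat :=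
  (\sum_(m <= s < n) (a s \in D))%N.

Definition npulls a (i : 'I_K) t : nat := pulls a [set i]%SET 0 t.

Definition observed a x t : R := x (a t) (npulls a (a t) t).

Definition emp_mean a x (i : 'I_K) t : R :=
  if npulls a i t == 0%N then 0
  else (\sum_(0 <= s < t | a s == i) observed a x s) / (npulls a i t)%:R.

Definition ucb L a x t (i : 'I_K) : R :=
  Num.min 1 (emp_mean a x i t + Num.sqrt (2 * L / (maxn (npulls a i t) 1)%:R)).

Definition radius L a t (i : 'I_K) : R :=
  Num.min 1 (2 * Num.sqrt (2 * L / (maxn (npulls a i t) 1)%:R)).

Definition remaining (b : 'I_B) t : R := (bend b - t)%N%:R.

(* The subtraction is truncated, which is the positive part of the deficit. *)
Definition deficit (b : 'I_B) a t : {set 'I_K} -> R :=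
  fun g => (flr b g - pulls a g (bstart b) t)%N%:R.

Definition slack (b : 'I_B) a t : R :=
  remaining b t - mc (groups I) (deficit b a t).

Definition preguard (b : 'I_B) a t : Prop :=
  (bstart b <= t < bend b)%N /\
  forall s, (bstart b <= s <= t)%N -> 2 * K%:R < slack b a s.

Definition guard_fires (b : 'I_B) a t : Prop :=
  [/\ (bstart b <= t < bend b)%N, slack b a t <= 2 * K%:R &
      forall s, (bstart b <= s < t)%N -> 2 * K%:R < slack b a s].

Definition sampling_prob L (b : 'I_B) a x t (i : 'I_K) : R :=
  opt_plan (groups I) (ucb L a x t) (remaining b t) (deficit b a t) 0 i
  / remaining b t.

Definition committed (b : 'I_B) a t (i : 'I_K) : nat :=
  `|Num.ceil (min_cover (groups I) (deficit b a t) 0%R i)|%N.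

(* If the guard of block [b] fires at round [t], the committed pulls occupy the
   rounds from [t] to [t + n] (excluded), in an arbitrary order, and each later
   round of the block pulls an arm whose current index is maximal, with
   arbitrary tie-breaking. *)
Definition guard_rule L a x : Prop :=
  forall b t, guard_fires b a t ->
    let n := (\sum_i committed b a t i)%N in
    (forall i, pulls a [set i]%SET t (t + n) = committed b a t i) /\
    (forall s, (t + n <= s < bend b)%N ->
       forall j, ucb L a x s j <= ucb L a x s (a s)).

Definition descent_at L (b : 'I_B) a x t : Prop :=
  let r := remaining b t in
  let d := deficit b a t in
  let p := sampling_prob L b a x t in
  (\sum_i p i * mc (groups I) (dplus d i) <= (r - 1) / r * mc (groups I) d) /\
  (\sum_i p i * (Psi (groups I) (@mean _ I) (r - 1) (dplus d i) + mean i)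
     >= Psi (groups I) (@mean _ I) r d - \sum_i p i * radius L a t i).

End Algorithm.

Definition mutually_independent (R : realType) (d d' : measure_display)
    (T : measurableType d) (T' : measurableType d') (P : probability T R)
    (J : eqType) (Y : J -> T -> T') : Prop :=
  forall (s : seq J) (E : J -> set T'), uniq s ->
    (forall j, measurable (E j)) ->
    P (\bigcap_(j in [set` s]) (Y j @^-1` E j)) =
      (\prod_(j <- s) P (Y j @^-1` E j))%E.

Section Run.
Context (R : realType) (I : problem R) (d : measure_display)
  (T : measurableType d) (P : probability T R).
Local Notation K := (narms I).

Definition reward_table := 'I_K -> nat -> {RV P >-> R}.

Implicit Types (X : reward_table) (A : nat -> T -> 'I_K) (L : R).

Definition rewards X : Prop :=
  [/\ forall i n w, 0 <= X i n w <= 1,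
      forall i n, distribution P (X i n) =1 distribution P (X i 0%N),
      forall i n, ('E_P[X i n] = (mean i)%:E)%E &
      mutually_independent P (fun k : 'I_K * nat => X k.1 k.2 : T -> R)].

Definition path A (w : T) : nat -> 'I_K := fun t => A t w.
Definition table X (w : T) : 'I_K -> nat -> R := fun i n => X i n w.

(* The sigma-algebra generated by the arms pulled before round [t] together
   with the whole reward table. *)
Definition past X A (t : nat) : set (set T) :=
  <<s [set F | (exists i n V, measurable V /\ F = X i n @^-1` V) \/
               (exists s i, (s < t)%N /\ F = A s @^-1` [set i])] >>.

(* Conditioning on the whole reward table, rather than on the observed rewards
   only, expresses that the draws use randomness independent of the rewards:
   given [past X A t], the arm of a pre-guard round [t] has law
   [sampling_prob]. The guard phase is prescribed on every sample path. *)
Definition pbdq_ucb L X A : Prop :=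
  [/\ forall t i, measurable (A t @^-1` [set i]),
      forall (b : 'I_(nblocks I)) (t : nat) (i : 'I_K) (F : set T),
        (bstart b <= t < bend b)%N -> past X A t F ->
        let D := F `&` [set w | preguard b (path A w) t] in
        P (D `&` A t @^-1` [set i]) =
          (\int[P]_(w in D)
             (sampling_prob L b (path A w) (table X w) t i)%:E)%E &
      forall w, guard_rule L (path A w) (table X w)].

Definition concentration L X : set T :=
  [set w | forall (i : 'I_K) (n : nat), (1 <= n <= horizon I)%N ->
     `|(\sum_(k < n) X i k w) / n%:R - mean i| <= Num.sqrt (2 * L / n%:R)].

(* States that the algorithm generates with probability 0 are disregarded,
   hence the almost-everywhere quantification over sample paths. *)
Definition descent_condition (eta sigma : R) X A (b : 'I_(nblocks I)) : Prop :=
  let L := conf_level I eta in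
  sigma * (blen b)%:R <= (blen b)%:R - mc (groups I) (floor_demand b) /\
  {ae P, forall w, concentration L X w ->
     forall t, preguard b (path A w) t ->
       descent_at L b (path A w) (table X w) t}.

Definition meets_floors A : Prop :=
  forall (w : T) (b : 'I_(nblocks I)) (g : {set 'I_K}), g \in groups I ->
    (flr b g <= pulls (path A w) g (bstart b) (bend b))%N.

Definition expected_value A : \bar R :=
  ('E_P[fun w => (\sum_(0 <= t < horizon I) mean (A t w))%R])%E.

Definition expected_regret A : \bar R := ((OPTfrac I)%:E - expected_value A)%E.

End Run.

(* Main.v *)
Require Import Defs.
From mathcomp Require Import measurable_realfun zify ring lra.

(** Let [E] be the concentration event. The radii are bounded along every sample
    path by [K + 4 sqrt (2 K T L)], so it remains to control the loss of each
    block at its guard. In a block with [r] remaining rounds and covering number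
    [m], the process [m / r] is a supermartingale on [E], starts below
    [1 - sigma], and must exceed [1 - 2 K / r] when the guard fires. Hence
    [(m - (1 - sigma) r)^+ ^ 2 / r + 2 ln r] is a supermartingale as well, which
    bounds the expected number of rounds left at the guard by
    [O (ln T / sigma ^ 2 + K / sigma)]. Since [Psi] is at most the number of
    rounds left, adding this potential to the descent inequality for [Psi] and
    telescoping over each block gives the regret bound. *)

Set Implicit Arguments.
Unset Strict Implicit.
Unset Printing Implicit Defensive.

Import HBSimple HBNNSimple.

Local Open Scope classical_set_scope.
Local Open Scope ring_scope.

(** * Integrals of nonmeasurable functions *)

(** The descent condition is available only on [E], and restricting to an event may spoil the
    sampling law. Here the law of a pre-guard arm is conditional on the whole reward table, and [E]
    depends on that table alone; it thus belongs to the past of every round, and one-round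
    inequalities may be integrated over [E] intersected with a prefix of arms. Arms and rounds being
    finite in number, expectations become finite sums over traces, weighted by their probability
    within [E]. The total weight is at least [1 - 2 eta], and since [OPTfrac] is at most the
    horizon, the missing mass costs at most [2 eta] times the horizon. A second obstacle is that the
    plan is a lexicographically first extreme point, whose measurability in the rewards is not
    established; integrals of sampling probabilities are therefore handled through simple minorants.
    No stopping theorem is invoked: the gain of a round is set to 0 from the guard on, and
    telescoping is done path by path before averaging. *)

Lemma integral_simple_approx (R : realType) (d : measure_display)
    (T : measurableType d) (P : probability T R) (F : set T) (f : T -> R)
    (q e : R) :
  (forall w, F w -> 0 <= f w) -> (\int[P]_(w in F) (f w)%:E = q%:E)%E ->
  0 < e ->
  exists2 g : {nnsfun T >-> R}, (forall w : T, g w <= (f \_ F) w) &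
    ((q - e)%:E < \int[P]_w (g w)%:E)%E.
Proof.
move=> f0; rewrite ge0_integralE; last by move=> w Fw; rewrite lee_fin f0.
move=> fq e0.
have /ereal_sup_gt[_ [g /= gf <-] qg] : ((q - e)%:E <
    ereal_sup [set sintegral P h | h in [set h : {nnsfun T >-> R} |
      forall x : T, ((h x)%:E <= ((fun w => (f w)%:E) \_ F) x)%E]])%E.
  by rewrite fq lte_fin ltrBlDr ltrDl.
exists g; last by rewrite integralT_nnsfun.
move=> w; have := gf w; rewrite /patch; case: ifP => _; by rewrite lee_fin.
Qed.

(* The integrands [p i] need not be measurable: the integral of a nonnegative
   function is a supremum over simple minorants, hence superadditive, and
   superadditivity applied to the weights [M - a i] suffices. *)
Lemma ge0_sum_mul_integral (R : realType) (d : measure_display)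
    (T : measurableType d) (P : probability T R) (F : set T) (n : nat)
    (p : 'I_n -> T -> R) (q a : 'I_n -> R) :
  measurable F -> (forall i w, F w -> 0 <= p i w) ->
  (forall w, F w -> \sum_i p i w <= 1) ->
  (forall i, (\int[P]_(w in F) (p i w)%:E = (q i)%:E)%E) ->
  (P F = (\sum_i q i)%:E)%E ->
  {ae P, forall w, F w -> 0 <= \sum_i a i * p i w} ->
  0 <= \sum_i a i * q i.
Proof.
move=> mF p0 p1 pq PF ae0.
pose M : R := \sum_i `|a i|; pose c i : R := M - a i.
have aM i : `|a i| <= M.
  by rewrite /M (bigD1 i)//= lerDl sumr_ge0.
have M0 : 0 <= M by rewrite sumr_ge0.
have c0 i : 0 <= c i by rewrite subr_ge0 (le_trans (ler_norm _)).
suff : \sum_i c i * q i <= M * \sum_i q i.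
  rewrite mulr_sumr -subr_ge0 -sumrB.
  by under eq_bigr do rewrite /c -mulrBl opprB addrC subrK.
apply/ler_addgt0Pr => e e0.
(* Replacing each [p i] by a simple minorant loses [e' * \sum_i c i] in total, hence at most [e];
   the [1 +] covers the case where all weights vanish. *)
pose e' := e / (1 + \sum_i c i).
have C0 : 0 < 1 + \sum_i c i by rewrite ltr_pwDl// sumr_ge0.
have e'0 : 0 < e' by rewrite divr_gt0.
have /choice[g gP] i : exists g : {nnsfun T >-> R},
    (forall w : T, g w <= (p i \_ F) w) /\ ((q i - e')%:E < \int[P]_w (g w)%:E)%E.
  by have [g ? ?] := integral_simple_approx (p0 i) (pq i) e'0; exists g.
have gle : (\int[P]_w (\sum_i (c i)%:E * (g i w)%:E) <= (M * \sum_i q i)%:E)%E.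
  have -> : ((M * \sum_i q i)%:E = \int[P]_w (M * \1_F w)%:E)%E.
    rewrite EFinM -PF -[F in P F]setIT -integral_indic// -ge0_integralZl//.
    by apply/measurable_EFinP; exact: measurable_indic.
  apply: ae_ge0_le_integral => //.
  - by move=> w _; apply: sume_ge0 => i _; rewrite mule_ge0// lee_fin.
  - apply: emeasurable_sum => i; apply: emeasurable_funM => //.
    exact/measurable_EFinP.
  - by move=> w _; rewrite lee_fin mulr_ge0// indicE.
  - apply/measurable_EFinP; apply: measurable_funM => //.
  move: ae0; apply: filterS => w aw _.
  under eq_bigr do rewrite -EFinM; rewrite sumEFin lee_fin indicE.
  have gp i : g i w <= (p i \_ F) w by have [] := gP i.
  have [wF|wF] := boolP (w \in F).
    rewrite mulr1; have Fw := set_mem wF.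
    apply: (@le_trans _ _ (\sum_i c i * p i w)).
      apply: ler_sum => i _; rewrite ler_wpM2l//.
      by have := gp i; rewrite /patch wF.
    (* On [F], the sum of the [c i * p i w] is [M * \sum_i p i w] minus a quantity that is
       nonnegative almost everywhere, so it is at most [M]. *)
    rewrite /c; under eq_bigr do rewrite mulrBl.
    rewrite sumrB -mulr_sumr lerBlDr (le_trans (_ : _ <= M))//.
      by rewrite ler_piMr// p1.
    by rewrite lerDl aw.
  rewrite mulr0 sumr_le0// => i _; rewrite mulr_ge0_le0//.
  by have := gp i; rewrite /patch (negbTE wF).
move: gle; rewrite ge0_integral_sum//; last 2 first.
- move=> i; apply: emeasurable_funM => //; exact/measurable_EFinP.
- by move=> i w _; rewrite mule_ge0// lee_fin.
move=> gle.
suff : (\sum_i c i * (q i - e') <= M * \sum_i q i).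
  under eq_bigr do rewrite mulrBr.
  rewrite sumrB -mulr_suml lerBlDr => /le_trans; apply.
  rewrite lerD2l /e' mulrCA ger_pMr// ler_pdivrMr// mul1r lerDr //.
rewrite -lee_fin (le_trans _ gle)// -sumEFin lee_sum// => i _.
rewrite ge0_integralZl//.
- by rewrite EFinM lee_wpmul2l// ?lee_fin// ; have [_ /ltW] := gP i.
- exact/measurable_EFinP.
- by move=> w _; rewrite lee_fin.
- by rewrite lee_fin.
Qed.

(** * Concentration *)

Lemma fsbig_setT (R : Type) (idx : R) (op : Monoid.com_law idx) (I : finType)
    (F : I -> R) : \big[op/idx]_(i \in [set: I]) F i = \big[op/idx]_i F i.
Proof.
rewrite [RHS]fsbig_seq ?index_enum_uniq//; apply: eq_fsbigl.
by apply/seteqP; split => // i _ /=; exact: mem_index_enum.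
Qed.

Lemma measure_fin_cover (R : realType) (d : measure_display)
    (T : measurableType d) (P : probability T R) (I : finType)
    (D : set T) (A : I -> set T) :
  measurable D -> (forall i, measurable (A i)) -> D `<=` \bigcup_i A i ->
  (P D <= \sum_i P (A i))%E.
Proof.
move=> mD mA DA; rewrite -fsbig_setT; apply: content_sub_fsum => //.
exact: finite_finset.
Qed.

Lemma measure_fin_partition (R : realType) (d : measure_display)
    (T : measurableType d) (P : probability T R) (I : finType)
    (D : set T) (A : I -> set T) :
  measurable D -> (forall i, measurable (A i)) -> trivIset setT A ->
  D `<=` \bigcup_i A i -> P D = (\sum_i P (D `&` A i))%E.
Proof.
move=> mD mA tA DA; rewrite -fsbig_setT -measure_fin_bigcup//.
- by move/setIidPl: DA; rewrite -setI_bigcupr => ->.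
- exact: finite_finset.
- exact: trivIset_setIl.
- by move=> i _; exact: measurableI.
Qed.

(** Squaring [expR (y / 2) <= 1 / (1 - y / 2)] leaves a polynomial inequality, whose difference
    factors as [y ^+ 2 * (5 - 2 * y) * (1 - y) / 4]. *)
Lemma expR_le_quadratic (R : realType) (y : R) :
  y <= 1 -> expR y <= 1 + y + 2 * y ^+ 2.
Proof.
move=> y1; have h0 : 0 < 1 - y / 2 by lra.
have h : expR (y / 2) * (1 - y / 2) <= 1.
  have := expR_ge1Dx (- (y / 2)).
  rewrite expRN -(ler_pM2l (expR_gt0 (y / 2))) divff//.
  by rewrite gt_eqF// expR_gt0.
have h2 : expR y * (1 - y / 2) ^+ 2 <= 1.
  rewrite [y in expR y](_ : y = y / 2 *+ 2); last by rewrite -mulr_natr; field.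
  rewrite mulr2n expRD -expr2 -exprMn exprn_ile1// ?mulr_ge0 ?expR_ge0 ?ltW//.
rewrite -(ler_pM2r (exprn_gt0 2 h0)); apply: (le_trans h2).
rewrite -subr_ge0; have -> : (1 + y + 2 * y ^+ 2) * (1 - y / 2) ^+ 2 - 1
  = y ^+ 2 * ((5 - 2 * y) * (1 - y)) / 4 by field.
by rewrite divr_ge0// mulr_ge0 ?sqr_ge0// mulr_ge0//; lra.
Qed.

Lemma expR_half_le2 (R : realType) : expR (2^-1 : R) <= 2.
Proof.
have := expR_ge1Dx (- 2^-1 : R).
rewrite expRN -(ler_pM2l (expR_gt0 (2^-1 : R))) divff ?gt_eqF ?expR_gt0//.
by move=> h; lra.
Qed.

(* The variance of a [0, 1]-valued variable is at most 1/4, which makes up for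
   the crude constant in [expR_le_quadratic]. *)
Lemma mgf_le (R : realType) (I : finType) (v q : I -> R) (l : R) :
  (forall i, 0 <= q i) -> \sum_i q i = 1 -> (forall i, 0 <= v i <= 1) ->
  0 <= l <= 1 ->
  \sum_i q i * expR (l * v i) <= expR (l * (\sum_i q i * v i) + l ^+ 2 / 2).
Proof.
move=> q0 q1 v01 /andP[l0 l1]; set m := \sum_i q i * v i.
have m0 : 0 <= m.
  by apply: sumr_ge0 => i _; rewrite mulr_ge0//; case/andP: (v01 i).
have m2 : \sum_i q i * v i ^+ 2 <= m.
  apply: ler_sum => i _; rewrite ler_wpM2l// expr2 ler_piMl//;
    by case/andP: (v01 i).
have -> : \sum_i q i * expR (l * v i) =
    expR (l * m) * \sum_i q i * expR (l * (v i - m)).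
  rewrite mulr_sumr; apply: eq_bigr => i _.
  by rewrite mulrCA -expRD; congr (_ * expR _); ring.
rewrite expRD ler_pM2l ?expR_gt0//.
apply: (le_trans _ (expR_ge1Dx _)).
have -> : 1 + l ^+ 2 / 2 = \sum_i q i * (1 + l * (v i - m)) + l ^+ 2 / 2.
  congr (_ + _); under eq_bigr do rewrite mulrDr mulr1.
  rewrite big_split/= q1.
  have -> : \sum_i q i * (l * (v i - m)) = \sum_i (l * (q i * v i) - l * m * q i).
    by apply: eq_bigr => i _; ring.
  by rewrite sumrB -!mulr_sumr q1 -/m mulr1 subrr addr0.
apply: (@le_trans _ _ (\sum_i q i * (1 + l * (v i - m) + 2 * (l * (v i - m)) ^+ 2))).
  apply: ler_sum => i _; rewrite ler_wpM2l// expR_le_quadratic//.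
  have /andP[vi0 vi1] := v01 i; nra.
under eq_bigr do rewrite mulrDr; rewrite big_split/= lerD2l.
have -> : \sum_i q i * (2 * (l * (v i - m)) ^+ 2) =
    2 * l ^+ 2 * (\sum_i q i * v i ^+ 2 - m ^+ 2).
  transitivity (\sum_i (2 * l ^+ 2 * (q i * v i ^+ 2)
     - 4 * l ^+ 2 * m * (q i * v i) + 2 * l ^+ 2 * m ^+ 2 * q i)).
    by apply: eq_bigr => i _; ring.
  by rewrite !big_split/= sumrN -!mulr_sumr q1 -/m; ring.
have : \sum_i q i * v i ^+ 2 - m ^+ 2 <= 1 / 4.
  have := sqr_ge0 (m - 1 / 2); nra.
have := sqr_ge0 l; nra.
Qed.

(* Rounds values of [0, 1] up to multiples of [1 / m]. *)
Definition cell (R : realType) (m : nat) (v : 'I_m.+1) : set R :=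
  [set y | v%:R - 1 < m%:R * y <= v%:R].

Lemma measurable_cell (R : realType) (m : nat) (v : 'I_m.+1) :
  measurable (@cell R m v).
Proof.
have -> : @cell R m v = ( *%R m%:R) @^-1` `]v%:R - 1, v%:R].
  by apply/seteqP; split => y; rewrite /cell/= in_itv.
rewrite -[X in measurable X]setTI.
have mm : measurable_fun setT ( *%R (m%:R : R)) by exact: measurable_funM.
exact: mm.
Qed.

Lemma trivIset_cell (R : realType) (m : nat) : trivIset setT (@cell R m).
Proof.
move=> u v _ _ [y [/= /andP[u1 u2] /andP[v1 v2]]]; apply/val_inj/eqP.
rewrite eqn_leq; apply/andP; split; rewrite -ltnS -(ltr_nat R) -natr1.
  by rewrite -ltrBlDr (lt_le_trans u1).
by rewrite -ltrBlDr (lt_le_trans v1).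
Qed.

Lemma cell_cover (R : realType) (m : nat) (y : R) : 0 <= y <= 1 ->
  exists v : 'I_m.+1, cell v y.
Proof.
move=> /andP[y0 y1].
have my0 : 0 <= m%:R * y by rewrite mulr_ge0.
have c0 : 0 <= Num.ceil (m%:R * y).
  by rewrite -(ler_int R) (le_trans my0)// ceil_ge.
have cm : Num.ceil (m%:R * y) <= m%:Z by rewrite ceil_le_int -pmulrn ler_piMr.
have hm : (`|Num.ceil (m%:R * y)| < m.+1)%N by rewrite ltnS -lez_nat gez0_abs.
exists (Ordinal hm); rewrite /cell/=.
have -> : (`|Num.ceil (m%:R * y)|%N)%:R = (Num.ceil (m%:R * y))%:~R :> R.
  by rewrite -[in RHS](gez0_abs c0).
by have := ceil_itv (m%:R * y); rewrite intrB.
Qed.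

(** A Chernoff bound with parameter [eps]. Independence is given for events only, so each variable
    is rounded up to a grid: the event is covered by the finitely many cell patterns [phi] whose
    rounded sum is large, and the exponential moment becomes a finite sum that factors over the
    coordinates. *)
Lemma deviation_le (R : realType) (d : measure_display)
    (T : measurableType d) (P : probability T R) (Y : nat -> T -> R)
    (mu eps : R) (n : nat) :
  (0 < n)%N -> (forall k, measurable_fun setT (Y k)) ->
  (forall k w, 0 <= Y k w <= 1) -> (forall k, ('E_P[Y k] = mu%:E)%E) ->
  mutually_independent P Y -> 0 < eps <= 1 ->
  (P [set w | (n%:R * (mu + eps) <= \sum_(k < n) Y k w)%R] <=
    (2 * expR (- (n%:R * eps ^+ 2 / 2)))%:E)%E.
Proof.
move=> n0 mY Y01 EY indY /andP[e0 e1].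
(* Rounding raises each mean by at most [1 / m], hence the exponent by at most
   [n * eps / m = eps / 2 <= 1 / 2]. This costs a factor [expR (1 / 2) <= 2], the factor 2 of the
   conclusion. *)
pose m := (2 * n)%N.
have m0 : (0 < m%:R :> R) by rewrite ltr0n muln_gt0.
have nR0 : (0 < n%:R :> R) by rewrite ltr0n.
have mYc k (v : 'I_m.+1) : measurable (Y k @^-1` cell v).
  by rewrite -[X in measurable X]setTI; apply: mY => //; exact: measurable_cell.
pose q k (v : 'I_m.+1) : R := fine (P (Y k @^-1` cell v)).
have qE k v : P (Y k @^-1` cell v) = (q k v)%:E by rewrite fineK// fin_num_measure.
have q0 k v : 0 <= q k v by rewrite fine_ge0.
have Ycover k w : exists v : 'I_m.+1, cell v (Y k w) by exact: cell_cover.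
have q1 k : \sum_v q k v = 1.
  apply: EFin_inj; rewrite -sumEFin -(@probability_setT _ _ _ P).
  rewrite (@measure_fin_partition _ _ _ P _ setT (fun v => Y k @^-1` @cell R m v))//.
  - by apply: eq_bigr => v _; rewrite setTI qE.
  - move=> u v _ _ [w [/= wu wv]]; apply: (@trivIset_cell R m) => //.
    by exists (Y k w).
  - by move=> w _; have [v ?] := Ycover k w; exists v.
pose val (v : 'I_m.+1) : R := v%:R / m%:R.
have val01 v : 0 <= val v <= 1.
  by rewrite /val divr_ge0//= ler_pdivrMr// mul1r ler_nat -ltnS.
have qm k : \sum_v q k v * val v <= mu + m%:R^-1.
  rewrite -lee_fin EFinD -(EY k) expectation.unlock.
  have -> : (m%:R^-1)%:E = (\int[P]_w (m%:R^-1)%:E)%E.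
    by rewrite integral_cst// [X in (_ * X)%E](@probability_setT _ _ _ P) mule1.
  rewrite -ge0_integralD//; last 2 first.
  - by move=> w _; rewrite lee_fin; case/andP: (Y01 k w).
  - exact/measurable_EFinP.
  have -> : (\sum_v q k v * val v)%:E =
      (\int[P]_w \sum_v (val v)%:E * (\1_(Y k @^-1` cell v) w)%:E)%E.
    rewrite ge0_integral_sum//; last 2 first.
    - move=> v; apply: emeasurable_funM => //; apply/measurable_EFinP.
      exact: measurable_indic.
    - by move=> v w _; rewrite mule_ge0// lee_fin ?indicE//; case/andP: (val01 v).
    rewrite -sumEFin; apply: eq_bigr => v _; rewrite ge0_integralZl//; last 2 first.
    - apply/measurable_EFinP; exact: measurable_indic.
    - by rewrite lee_fin; case/andP: (val01 v).
    by rewrite integral_indic// setIT [X in (_ * X)%E]qE -EFinM mulrC.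
  apply: ge0_le_integral => //.
  - move=> w _; apply: sume_ge0 => v _; rewrite mule_ge0// lee_fin ?indicE//.
    by case/andP: (val01 v).
  - apply: emeasurable_sum => v; apply: emeasurable_funM => //.
    by apply/measurable_EFinP; exact: measurable_indic.
  - by apply: emeasurable_funD => //; exact/measurable_EFinP.
  move=> w _; rewrite -EFinD; have [v cv] := Ycover k w.
  under eq_bigr do rewrite -EFinM; rewrite sumEFin lee_fin (bigD1 v)//= big1.
    rewrite addr0 indicE mem_set// mulr1 /val ler_pdivrMr// mulrDl.
    rewrite mulVf ?gt_eqF//; have /andP[+ _] := cv; lra.
  move=> u uv; rewrite indicE memNset ?mulr0// => cu.
  move/eqP: uv; apply; apply: (@trivIset_cell R m) => //.
  by exists (Y k w).
pose c (phi : {ffun 'I_n -> 'I_m.+1}) : set T :=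
  [set w | forall k : 'I_n, cell (phi k) (Y k w)].
have Pc phi : P (c phi) = (\prod_(k < n) q k (phi k))%:E.
  (* Independence speaks of families indexed by all of [nat]; the values of [ext] from [n] on are
     irrelevant. *)
  pose ext j : 'I_m.+1 := if insub j is Some k then phi k else ord0.
  have extE (k : 'I_n) : ext k = phi k by rewrite /ext valK.
  have indn : P (\bigcap_(j in [set` iota 0 n]) (Y j @^-1` cell (ext j))) =
      (\prod_(j < n) P (Y j @^-1` cell (ext j)))%E.
    rewrite -(big_mkord xpredT (fun j => P (Y j @^-1` cell (ext j)))).
    rewrite /index_iota subn0.
    exact: (indY _ (fun j => @cell R m (ext j)) (iota_uniq 0 n)
      (fun j => measurable_cell _)).
  rewrite (_ : c phi = \bigcap_(j in [set` iota 0 n]) Y j @^-1` cell (ext j)).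
    rewrite indn -prodEFin; apply: eq_bigr => k _.
    by rewrite extE qE.
  apply/seteqP; split => w cw.
    move=> j /=; rewrite mem_iota add0n => /= jn.
    by have := cw (Ordinal jn); rewrite -extE.
  move=> k; rewrite -extE; apply: cw => /=; by rewrite mem_iota add0n/=.
pose Q (phi : {ffun 'I_n -> 'I_m.+1}) := n%:R * (mu + eps) <= \sum_(k < n) val (phi k).
pose B phi : set T := if Q phi then c phi else set0.
have mc phi : measurable (c phi).
  rewrite (_ : c phi = \bigcap_(k : 'I_n) (Y k @^-1` cell (phi k))).
    exact: fin_bigcap_measurable.
  by apply/seteqP; split => w cw k => [_|]; [exact: cw|exact: (cw k I)].
have /le_trans : (P [set w | (n%:R * (mu + eps) <= \sum_(k < n) Y k w)%R]
    <= \sum_phi P (B phi))%E.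
  apply: measure_fin_cover => //.
  - rewrite -[X in measurable X]setTI.
    have mS : measurable_fun setT (fun w => \sum_(k < n) Y k w).
      exact: measurable_sum.
    have -> : [set w | n%:R * (mu + eps) <= \sum_(k < n) Y k w] =
       (fun w => \sum_(k < n) Y k w) @^-1` `[n%:R * (mu + eps), +oo[.
      by apply/seteqP; split => w /=; rewrite in_itv/= andbT.
    exact: mS.
  - by move=> phi; rewrite /B; case: ifP.
  move=> w /= Yw; have [phi phiP] := choice (fun k : 'I_n => Ycover k w).
  exists [ffun k => phi k] => //; rewrite /B ifT.
    by move=> k; rewrite ffunE.
  rewrite /Q (le_trans Yw)//; apply: ler_sum => k _.
  rewrite ffunE /val ler_pdivlMr// mulrC.
  by case/andP: (phiP k).
apply.
(* Markov's inequality, one pattern at a time: the exponential factor is at least 1 on the patterns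
   satisfying [Q], and the other patterns contribute 0. *)
apply: (@le_trans _ _ (\sum_(phi : {ffun 'I_n -> 'I_m.+1})
   (expR (- (eps * (n%:R * (mu + eps)))) *
       \prod_(k < n) (q k (phi k) * expR (eps * val (phi k))))%:E)).
  apply: lee_sum => phi _; rewrite /B; case: ifPn => [Qphi|_].
    rewrite Pc lee_fin big_split/= mulrCA ler_peMr// ?prodr_ge0//.
    rewrite -expR_sum -expRD -[leLHS](@expR0 R) ler_expR addrC subr_ge0.
    by rewrite -mulr_sumr; apply: ler_wpM2l; first exact: ltW.
  rewrite [X in (X <= _)%E]measure0 lee_fin mulr_ge0 ?expR_ge0// prodr_ge0// => k _.
  by rewrite mulr_ge0 ?expR_ge0.
rewrite sumEFin lee_fin -mulr_sumr
    -(bigA_distr_bigA (fun (k : 'I_n) v => q k v * expR (eps * val v))).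
have le1 (k : 'I_n) : \sum_v q k v * expR (eps * val v) <=
    expR (eps * (mu + m%:R^-1) + eps ^+ 2 / 2).
  apply: (le_trans (mgf_le (q0 k) (q1 k) val01 _)); first by rewrite e1 ltW.
  by rewrite ler_expR lerD2r ler_wpM2l// ltW.
apply: (@le_trans _ _ (expR (- (eps * (n%:R * (mu + eps)))) *
   \prod_(k < n) expR (eps * (mu + m%:R^-1) + eps ^+ 2 / 2))).
  rewrite ler_wpM2l ?expR_ge0//; apply: ler_prod => k _; rewrite le1 andbT.
  by apply: sumr_ge0 => v _; rewrite mulr_ge0 ?expR_ge0.
rewrite prodr_const card_ord -expRM_natl -expRD.
apply: (@le_trans _ _ (expR (2^-1 + - (n%:R * eps ^+ 2 / 2)))).
  rewrite ler_expR /m natrM.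
  have -> : - (eps * (n%:R * (mu + eps))) +
    n%:R * (eps * (mu + (2 * n%:R)^-1) + eps ^+ 2 / 2) =
    eps / 2 + - (n%:R * eps ^+ 2 / 2) by field; rewrite gt_eqF.
  rewrite lerD2r; lra.
by rewrite expRD ler_wpM2r ?expR_ge0// expR_half_le2.
Qed.

(** Stated over an arbitrary measurable type, because it serves both for the ambient sigma-algebra
    and for the one generated by the past of a round. *)
Lemma measurable_uniform_deviation (R : realType) (d : measure_display)
    (T : measurableType d) (K N : nat) (x : 'I_K -> nat -> T -> R)
    (mu : 'I_K -> R) (b : nat -> R) :
  (forall i n, measurable_fun setT (x i n)) ->
  measurable [set w | forall (i : 'I_K) (n : nat), (1 <= n <= N)%N ->
     `|(\sum_(k < n) x i k w) / n%:R - mu i| <= b n].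
Proof.
move=> mx; pose f (i : 'I_K) n w := `|(\sum_(k < n) x i k w) / n%:R - mu i|.
have mf i n : measurable_fun setT (f i n).
  apply: measurableT_comp => //; apply: measurable_funB => //.
  by apply: measurable_funM => //; exact: measurable_sum.
rewrite (_ : mkset _ = \bigcap_(i : 'I_K) \bigcap_(n in [set n | (1 <= n <= N)%N])
    (f i n @^-1` `]-oo, b n])).
  apply: fin_bigcap_measurable => // i _; apply: fin_bigcap_measurable.
    by apply: (sub_finite_set _ (finite_II N.+1)) => n /andP[].
  move=> n _; rewrite -[X in measurable X]setTI; exact: mf.
apply/seteqP; split => w /= h i.
  by move=> _ n nN; rewrite /= in_itv/=; exact: h.
by move=> n nN; have := h i I n nN; rewrite /= in_itv.
Qed.

Section Concentration.
Context (R : realType) (I : problem R) (d : measure_display)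
  (T : measurableType d) (P : probability T R) (X : reward_table I P)
  (rX : rewards X).
Local Notation K := (narms I).

Lemma mean_01 (i : 'I_K) : 0 <= mean i <= 1.
Proof.
have [X01 _ EX _] := rX; rewrite -!lee_fin -(EX i 0%N) expectation.unlock.
apply/andP; split.
  by apply: integral_ge0 => w _; rewrite lee_fin; case/andP: (X01 i 0%N w).
rewrite (@le_trans _ _ (\int[P]_w (cst 1) w)%E)//; last first.
  by rewrite integral_cst// [X in (_ * X)%E](@probability_setT _ _ _ P) mule1.
apply: ge0_le_integral => //.
- by move=> w _; rewrite lee_fin; case/andP: (X01 i 0%N w).
- exact/measurable_EFinP.
- by move=> w _; rewrite lee_fin; case/andP: (X01 i 0%N w).
Qed.

(** Lower deviations of the rewards are upper deviations of their complements [1 - X i n], which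
    therefore need a mean and, below, independence. *)
Lemma expectation_onem (i : 'I_K) n :
  ('E_P[fun w => (1 - X i n w)%R] = (1 - mean i)%:E)%E.
Proof.
have [X01 _ EX _] := rX.
have : ('E_P[fun w => (1 - X i n w)%R] + 'E_P[X i n] = 1%:E)%E.
  rewrite expectation.unlock -ge0_integralD//.
  - under eq_integral do rewrite -EFinD subrK.
    by rewrite integral_cst// [X in (_ * X)%E](@probability_setT _ _ _ P) mule1.
  - by move=> w _; rewrite lee_fin subr_ge0; case/andP: (X01 i n w).
  - by apply/measurable_EFinP; exact: measurable_funB.
  - by move=> w _; rewrite lee_fin; case/andP: (X01 i n w).
  - exact/measurable_EFinP.
by rewrite EX EFinB => <-; rewrite addeK.
Qed.

Lemma independent_arm (i : 'I_K) : mutually_independent P (X i : nat -> T -> R).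
Proof.
have [_ _ _ indX] := rX => s E us mE.
have := indX [seq (i, n) | n <- s] (fun k => E k.2) _ (fun k => mE k.2).
rewrite map_inj_uniq => [/(_ us)|m n [//]].
rewrite big_map => <-; congr (P _); apply/seteqP; split => w /= h.
  by move=> _ /mapP[n ns ->]; exact: h.
by move=> n ns; apply: (h (i, n)); apply/mapP; exists n.
Qed.

Lemma independent_arm_onem (i : 'I_K) :
  mutually_independent P (fun n w => 1 - X i n w : R).
Proof.
move=> s E us mE.
have := @independent_arm i s (fun n => (fun y : R => 1 - y) @^-1` E n) us.
apply => n; rewrite -[X in measurable X]setTI.
have m1 : measurable_fun setT (fun y : R => 1 - y) by exact: measurable_funB.
exact: m1.
Qed.

(** A union bound over arms, sample sizes and the two signs: [2 * K * H] events, where [H] is the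
    horizon, each of probability at most [2 * expR (- L) = eta / (K * H)]. *)
Lemma concentration_prob (eta : R) : 0 < eta < 1 -> (0 < horizon I)%N ->
  measurable (concentration (conf_level I eta) X) /\
  (P (~` concentration (conf_level I eta) X) <= (2 * eta)%:E)%E.
Proof.
move=> /andP[e0 e1] H0; have [X01 _ EX _] := rX.
have mX i n : measurable_fun setT (X i n) by [].
have KH0 : 0 < 2 * K%:R * (horizon I)%:R :> R.
  by rewrite !mulr_gt0// ltr0n// narms_gt0.
set L := conf_level I eta.
have mE : measurable (concentration L X).
  exact: (@measurable_uniform_deviation _ _ _ _ _ (fun i k => X i k : T -> R)
    (@mean _ I) (fun n => Num.sqrt (2 * L / n%:R)) mX).
split => //.
have L0 : 0 < L.
  rewrite ln_gt0// ltr_pdivlMr// mul1r (lt_le_trans e1)// -!natrM ler1n.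
  by rewrite !muln_gt0 narms_gt0.
have eL : expR (- L) = eta / (2 * K%:R * (horizon I)%:R).
  by rewrite expRN lnK ?posrE ?divr_gt0// invf_div.
pose eps n : R := Num.sqrt (2 * L / n%:R).
pose U (i : 'I_K) n : set T :=
  [set w | (n%:R * (mean i + eps n) <= \sum_(k < n) X i k w)%R].
pose D (i : 'I_K) n : set T :=
  [set w | (n%:R * ((1 - mean i) + eps n) <= \sum_(k < n) (1 - X i k w))%R].
have mS (Y : nat -> T -> R) n (a : R) : (forall k, measurable_fun setT (Y k)) ->
    measurable [set w | (a <= \sum_(k < n) Y k w)%R].
  move=> mY; rewrite -[X in measurable X]setTI.
  have mS : measurable_fun setT (fun w => \sum_(k < n) Y k w).
    exact: measurable_sum.
  have -> : [set w | a <= \sum_(k < n) Y k w] =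
      (fun w => \sum_(k < n) Y k w) @^-1` `[a, +oo[.
    by apply/seteqP; split => w /=; rewrite in_itv/= andbT.
  exact: mS.
have mU i n : measurable (U i n) by exact: (mS (fun k => X i k : T -> R)). 
have mD i n : measurable (D i n).
  by apply: (mS (fun k w => 1 - X i k w)) => k; exact: measurable_funB.
(* The sample size is the successor of an ordinal, as it starts from 1. Widths above 1 are outside
   the range of the tail bound, but averages and means in [[0, 1]] never differ by more than 1, so
   the event is then taken empty. *)
pose A (j : 'I_K * 'I_(horizon I) * bool) : set T :=
  let n := j.1.2.+1 in
  if 1 < eps n then set0 else if j.2 then U j.1.1 n else D j.1.1 n.
have mA j : measurable (A j) by rewrite /A; case: ifP => // _; case: ifP.
have PA j : (P (A j) <= (2 * expR (- L))%:E)%E.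
  rewrite /A; case: ltP => [_|en].
    by rewrite [X in (X <= _)%E]measure0 lee_fin mulr_ge0 ?expR_ge0.
  set n := j.1.2.+1 in en *.
  have e01 : 0 < eps n <= 1 by rewrite en andbT sqrtr_gt0 divr_gt0// mulr_gt0.
  have LE : n%:R * eps n ^+ 2 / 2 = L.
    rewrite sqr_sqrtr; last by rewrite divr_ge0// mulr_ge0// ltW.
    by field; rewrite pnatr_eq0.
  rewrite -LE; case: ifP => _.
    apply: (@deviation_le _ _ _ _ (fun k => X j.1.1 k : T -> R)) => //.
    exact: independent_arm.
  apply: (@deviation_le _ _ _ _ (fun k w => 1 - X j.1.1 k w)) => //.
  - by move=> k; exact: measurable_funB.
  - by move=> k w; have := X01 j.1.1 k w; lra.
  - exact: expectation_onem.
  - exact: independent_arm_onem.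
apply: (@le_trans _ _ (\sum_j P (A j))%E).
  apply: measure_fin_cover => //; first exact: measurableC.
  move=> w /= /existsNP[i /existsNP[n /not_implyP[/andP[n1 nH] /negP]]].
  rewrite -ltNge -/(eps n) => dev.
  have n0 : 0 < n%:R :> R by rewrite ltr0n.
  have nH' : (n.-1 < horizon I)%N by rewrite prednK.
  have nE : n.-1.+1 = n by rewrite prednK.
  set S := \sum_(k < n) X i k w in dev.
  have S0 : 0 <= S by apply: sumr_ge0 => k _; case/andP: (X01 i k w).
  have Sn : S <= n%:R.
    apply: (@le_trans _ _ (\sum_(k < n) 1)); last by rewrite sumr_const card_ord.
    by apply: ler_sum => k _; case/andP: (X01 i k w).
  have avg : 0 <= S / n%:R <= 1 by rewrite divr_ge0 ?ler0n// ler_pdivrMr ?mul1r.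
  have e1n : (1 < eps n) = false.
    apply/negP => h; move: dev; apply/negP; rewrite -leNgt (le_trans _ (ltW h))//.
    by have := mean_01 i; rewrite ler_norml; lra.
  move: dev; rewrite lter_normr => /orP[dev|dev].
    exists (i, Ordinal nH', true) => //; rewrite /A/= nE e1n /U/= -/S.
    rewrite mulrC -ler_pdivlMr//; lra.
  exists (i, Ordinal nH', false) => //; rewrite /A/= nE e1n /D/=.
  rewrite sumrB sumr_const card_ord -/S mulrC -ler_pdivlMr// mulrBl divff ?gt_eqF//.
  lra.
apply: (@le_trans _ _ (\sum_(j : 'I_K * 'I_(horizon I) * bool) (2 * expR (- L))%:E)%E).
  by apply: lee_sum => j _.
rewrite sumEFin sumr_const !card_prod !card_ord card_bool lee_fin eL.
rewrite -[leLHS]mulr_natl !natrM le_eqVlt; apply/orP; left; apply/eqP; field.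
by rewrite !pnatr_eq0 -!lt0n narms_gt0 H0.
Qed.
End Concentration.

(** * Covering numbers and plans *)

Lemma continuous_sum_coord (R : realType) (K : nat) (D : pred 'I_K) :
  continuous (fun y : 'rV[R]_K => \sum_(i | D i) y 0 i).
Proof.
apply: continuous_big => [|i _]; last exact: coord_continuous.
exact: add_continuous.
Qed.

Lemma lex_leP (R : realType) (K : nat) (y z : 'rV[R]_K) (k : 'I_K) :
  (forall j : 'I_K, (j < k)%N -> y 0 j = z 0 j) -> y 0 k < z 0 k -> lex_le y z.
Proof.
move=> yz ltk; apply/lexi_tupleP; exists (widen_ord (leqnSn K) k) => i /= ik.
rewrite !tnth_mktuple; have [->|neq] := eqVneq i k.
  rewrite eqxx/=; split; [exact: ltW|exact: lt_eqF].
rewrite neq yz; first by split; rewrite ?lexx ?eqxx.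
by rewrite ltn_neqAle ik andbT.
Qed.

(** Coordinates are minimised one after the other, each over the compact set of points still tied.
    The invariant for [m] coordinates is that the remaining points agree on them, and that every
    discarded point of [S] loses strictly at its first difference with each remaining one. *)
Lemma compact_lex_min (R : realType) (K : nat) (S : set 'rV[R]_K) :
  compact S -> S !=set0 -> exists y, S y /\ forall z, S z -> lex_le y z.
Proof.
move=> cS S0.
suff [S' [[y S'y] _ S'S eqS' minS']] : exists S' : set 'rV[R]_K,
    [/\ S' !=set0, compact S', S' `<=` S,
      (forall y z (i : 'I_K), S' y -> S' z -> (i < K)%N -> y 0 i = z 0 i) &
      (forall y z, S' y -> S z -> S' z \/ exists2 k : 'I_K,
        (forall j : 'I_K, (j < k)%N -> y 0 j = z 0 j) & y 0 k < z 0 k)].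
  exists y; split; first exact: S'S.
  move=> z Sz; have [S'z|[k yz ltk]] := minS' y z S'y Sz; last exact: lex_leP ltk.
  rewrite (_ : z = y) /lex_le ?lexx//.
  by apply/rowP => i; apply: eqS'.
suff : forall m, (m <= K)%N -> exists S' : set 'rV[R]_K,
    [/\ S' !=set0, compact S', S' `<=` S,
      (forall y z (i : 'I_K), S' y -> S' z -> (i < m)%N -> y 0 i = z 0 i) &
      (forall y z, S' y -> S z -> S' z \/ exists2 k : 'I_K,
        (forall j : 'I_K, (j < k)%N -> y 0 j = z 0 j) & y 0 k < z 0 k)].
  exact.
elim=> [_|m IH mK]; first by exists S; split => // y z _ ?; left.
have [S' [S'0 cS' S'S eqS' minS']] := IH (ltnW mK).
pose i := Ordinal mK.
have cf : continuous (fun y : 'rV[R]_K => y 0 i) by exact: coord_continuous.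
have [c /set_mem S'c cmin] := EVT_min_rV S'0 cS' (continuous_subspaceT cf).
exists (S' `&` [set y | y 0 i <= c 0 i]); split.
- by exists c; split => /=.
- apply: compact_closedI => //.
  exact: (proj1 (continuous_closedP _) cf _ (@closed_le R (c 0 i))).
- by move=> y [/S'S].
- move=> y z j [S'y yc] [S'z zc]; rewrite ltnS leq_eqVlt => /orP[/eqP ji|].
    have -> : j = i by apply: val_inj.
    have := cmin y (mem_set S'y); have := cmin z (mem_set S'z).
    move: yc zc => /= yc zc h1 h2; lra.
  exact: eqS'.
- move=> y z [S'y yc] Sz; have [S'z|?] := minS' y z S'y Sz; last by right.
  have [zc|cz] := leP (z 0 i) (c 0 i); first by left.
  right; exists i; last exact: le_lt_trans yc cz.
  by move=> j ji; apply: eqS'.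
Qed.

Section CoveringTheory.
Context (R : realType) (K : nat) (G : {set {set 'I_K}}) (G0 : finset.set0 \notin G).
Implicit Types (d : {set 'I_K} -> R) (y : 'rV[R]_K).

Lemma covers_nonempty d : covers G d !=set0.
Proof.
exists (const_mx (\sum_(g in G) `|d g|)); split => [i|g Gg].
  by rewrite mxE sumr_ge0.
have /set0Pn[i ig] : g != finset.set0 by apply: contraNneq G0 => <-.
rewrite (bigD1 i)//= mxE; apply: (@le_trans _ _ (\sum_(g in G) `|d g|)).
  by rewrite (bigD1 g)//= (le_trans (ler_norm _))// lerDl sumr_ge0.
by rewrite lerDl sumr_ge0// => j _; rewrite mxE sumr_ge0.
Qed.

Lemma total_ge0 d y : covers G d y -> 0 <= total y.
Proof. by move=> [y0 _]; exact: sumr_ge0. Qed.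

Lemma mc_le d y : covers G d y -> mc G d <= total y.
Proof.
move=> cy; apply: ge_inf; last by exists y.
by exists 0 => _ [z cz <-]; exact: total_ge0 cz.
Qed.

Lemma le_mc d (m : R) : (forall y, covers G d y -> m <= total y) -> m <= mc G d.
Proof.
move=> h; apply: lb_le_inf.
  by have [y cy] := covers_nonempty d; exists (total y); exists y.
by move=> _ [y cy <-]; exact: h.
Qed.

Lemma mc_ge0 d : 0 <= mc G d.
Proof. by apply: le_mc => y; exact: total_ge0. Qed.

Lemma mc_dplus_le d i : (forall g, 0 <= d g) -> mc G (dplus d i) <= mc G d.
Proof.
move=> d0; apply: le_mc => y [y0 cy]; apply: mc_le; split => // g Gg.
apply: le_trans (cy g Gg); rewrite /dplus ge_max d0 andbT.
by rewrite lerBlDr lerDl ler0n.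
Qed.

(** Adding one unit of arm [i] to a cover of the reduced demand gives a cover of [d]. *)
Lemma le_mc_dplus d i : mc G d - 1 <= mc G (dplus d i).
Proof.
apply: le_mc => y [y0 cy]; rewrite lerBlDr.
have -> : total y + 1 = total (y + delta_mx 0 i).
  rewrite /total; under [RHS]eq_bigr do rewrite !mxE.
  rewrite big_split/=; congr (_ + _); rewrite (bigD1 i)//= !eqxx big1 ?addr0//.
  by move=> j /negbTE ->.
apply: mc_le; split => [j|g Gg]; first by rewrite !mxE addr_ge0.
under eq_bigr do rewrite !mxE; rewrite big_split/=.
have := cy g Gg; rewrite /dplus ge_max lerBlDr => /andP[h _].
apply: (le_trans h); rewrite lerD2l; have [ig|] := boolP (i \in g) => /=.
  by rewrite (bigD1 i)//= eqxx lerDl sumr_ge0.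
by move=> _; rewrite sumr_ge0.
Qed.

(** Covers of bounded total form a compact set, so the minimum is attained and its minimisers are
    again compact. A lexicographically first one thus exists, and [xget] does not fall back on its
    default. *)
Lemma min_coverP d : covers G d (min_cover G d) /\ total (min_cover G d) = mc G d.
Proof.
have ct : continuous (@total R K) by exact: continuous_sum_coord.
pose S M := covers G d `&` [set y | total y <= M].
have closed_covers : closed (covers G d).
  rewrite (_ : covers G d = \bigcap_(i : 'I_K) ((fun y : 'rV_K => y 0 i) @^-1` [set x | 0 <= x])
    `&` \bigcap_(g in [set g | g \in G]) ((fun y : 'rV_K => \sum_(i in g) y 0 i)
        @^-1` [set x | d g <= x])).
    apply: closedI.
      apply: closed_bigI => i _; apply: (proj1 (continuous_closedP _)).
        exact: coord_continuous.
      exact: closed_ge.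
    apply: closed_bigI => g _; apply: (proj1 (continuous_closedP _)).
      exact: continuous_sum_coord.
    exact: closed_ge.
  apply/seteqP; split => y [y0 cy].
    by split=> [i _|g Gg]; [exact: y0|exact: cy].
  by split=> [i|g Gg]; [exact: (y0 i I)|exact: cy].
have cS M : compact (S M).
  apply: (@subclosed_compact _ _ [set y : 'rV[R]_K | forall i, `[0, M]%classic (y ord0 i)]).
  - apply: closedI => //.
    exact: (proj1 (continuous_closedP _) ct _ (@closed_le R M)).
  - apply: (@rV_compact R K (fun=> `[0, M]%classic)) => i.
    exact: segment_compact.
  - move=> y [[y0 cy] /= yM] i; rewrite /= in_itv/= y0/= (le_trans _ yM)//.
    by rewrite /total (bigD1 i)//= lerDl sumr_ge0.
have [y0 cy0] := covers_nonempty d.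
have [|c /set_mem[cc _] cmin] := EVT_min_rV _ (cS (total y0)) (continuous_subspaceT ct).
  by exists y0; split => /=.
have tc : total c = mc G d.
  apply/eqP; rewrite eq_le mc_le// andbT; apply: le_mc => y cy.
  have [yy0|yy0] := leP (total y) (total y0); first by apply: cmin; apply/mem_set.
  by rewrite (le_trans _ (ltW yy0))//; apply: cmin; apply/mem_set; split => /=.
have SE : [set y | covers G d y /\ total y = mc G d] = S (mc G d).
  apply/seteqP; split => y [cy /= ty]; split => //=; first by rewrite ty.
  by apply/eqP; rewrite eq_le ty mc_le.
rewrite /min_cover /lex_first; case: xgetP => [y _ [[]]//|].
have [z [Sz zmin]] : exists y, S (mc G d) y /\ forall z, S (mc G d) z -> lex_le y z.
  apply: compact_lex_min => //.
  by exists c; rewrite -SE.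
by move=> /(_ z); case; rewrite -SE in Sz zmin.
Qed.

(* [xget] yields the junk value [0] when there is no optimal extreme point; all
   sampling probabilities then vanish, which the argument tolerates. *)
Lemma opt_planP c r d :
  plans G r d (opt_plan G c r d) \/ opt_plan G c r d = 0.
Proof.
rewrite /opt_plan /lex_first; case: xgetP => [y _ [[[]]]|]; first by left.
by right.
Qed.

Lemma value_le_total (c : 'I_K -> R) y : (forall i, 0 <= y 0 i) ->
  (forall i, 0 <= c i <= 1) -> value c y <= total y.
Proof.
by move=> y0 c01; apply: ler_sum => i _; rewrite ler_piMl//; case/andP: (c01 i).
Qed.

Lemma Psi_le (c : 'I_K -> R) r d : 0 <= r -> (forall i, 0 <= c i <= 1) ->
  Psi G c r d <= r.
Proof.
move=> r0 c01; rewrite /Psi.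
(* Without any plan, [Psi] is the supremum of the empty set, namely 0. *)
have [->|/set0P nS] := eqVneq [set value c y | y in plans G r d] set0.
  by rewrite sup0.
apply: ge_sup => // _ [y [[y0 _] <-] <-]; exact: value_le_total.
Qed.

End CoveringTheory.

(** * The potential *)

(* The logarithm pays for the accumulated quadratic variation of [m / r]. *)
Definition potential (R : realType) (sigma r m : R) : R :=
  Num.max 0 (m - (1 - sigma) * r) ^+ 2 / r + 2 * ln r.

Section Potential.
Context (R : realType).
Implicit Types (sigma r m k : R).

Lemma ln_pred_le r : 1 < r -> r^-1 <= ln r - ln (r - 1).
Proof.
move=> r1; have r0 : 0 < r by lra.
rewrite -ln_div ?posrE ?subr_gt0// -ler_expR lnK ?posrE ?divr_gt0 ?subr_gt0//.
rewrite -[leLHS]invrK -[leRHS]invrK lef_pV2 ?posrE ?invr_gt0 ?divr_gt0 ?subr_gt0 ?expR_gt0//.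
rewrite -expRN invf_div mulrBl divff ?gt_eqF// mul1r.
exact: expR_ge1Dx.
Qed.

(** Write [m' i = al * m + xi i] with [al = (r - 1) / r]. The noise [xi] has nonpositive mean, and
    [|xi i| <= 1] because [m' i] and [al * m = m - m / r] both lie in [[m - 1, m]]. The mean square
    thus grows by at most 1 beyond [al ^+ 2 * u ^+ 2]. After division by [r - 1] the main term is at
    most [u ^+ 2 / r], and the noise costs [1 / (r - 1) <= 2 / r], which the decrease of [2 * ln r]
    pays. *)
Lemma potential_descent n (p m' : 'I_n -> R) sigma r m :
  (forall i, 0 <= p i) -> \sum_i p i = 1 -> 2 < r -> 0 <= m <= r ->
  (forall i, m - 1 <= m' i <= m) -> \sum_i p i * m' i <= (r - 1) / r * m ->
  \sum_i p i * potential sigma (r - 1) (m' i) <= potential sigma r m.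
Proof.
move=> p0 p1 r2 /andP[m0 mr] mm' pm'.
have r0 : 0 < r by lra.
have r10 : 0 < r - 1 by lra.
set u := Num.max 0 (m - (1 - sigma) * r).
pose al := (r - 1) / r; pose xi i := m' i - al * m.
have al0 : 0 <= al by rewrite divr_ge0// ltW.
have al1 : al <= 1 by rewrite ler_pdivrMr// mul1r; lra.
have u0 : 0 <= u by rewrite le_max lexx.
have alr : (1 - sigma) * (r - 1) = al * ((1 - sigma) * r).
  by rewrite /al; field; rewrite gt_eqF.
have alm : m - m / r = al * m by rewrite /al; field; rewrite gt_eqF.
have mr1 : 0 <= m / r <= 1 by rewrite divr_ge0 ?(ltW r0)// ler_pdivrMr ?mul1r.
have sq i : Num.max 0 (m' i - (1 - sigma) * (r - 1)) ^+ 2 <=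
    al ^+ 2 * u ^+ 2 + 2 * al * u * xi i + 1.
  have xi1 : xi i ^+ 2 <= 1.
    have := mm' i; rewrite /xi -alm => ?; nra.
  (* A nonzero positive part is at most [al * u + xi i], which is then positive as well, so squaring
     is monotone. *)
  apply: (@le_trans _ _ ((al * u + xi i) ^+ 2)); last by rewrite sqrrD; nra.
  have [h|h] := leP (m' i - (1 - sigma) * (r - 1)) 0.
    by rewrite expr0n/= sqr_ge0.
  have hz : m - (1 - sigma) * r <= u by rewrite le_max lexx orbT.
  have := ler_wpM2l al0 hz => hz'.
  have hq : m' i - (1 - sigma) * (r - 1) <= al * u + xi i.
    by rewrite alr /xi; lra.
  rewrite ler_sqr// ?nnegrE ?(ltW h)//; lra.
have ss : \sum_i p i * (al ^+ 2 * u ^+ 2 + 2 * al * u * xi i + 1) <=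
    al ^+ 2 * u ^+ 2 + 1.
  have -> : \sum_i p i * (al ^+ 2 * u ^+ 2 + 2 * al * u * xi i + 1) =
     (al ^+ 2 * u ^+ 2 + 1) * \sum_i p i +
     2 * al * u * (\sum_i p i * m' i - al * m * \sum_i p i).
    transitivity (\sum_i ((al ^+ 2 * u ^+ 2 + 1) * p i +
      2 * al * u * (p i * m' i - al * m * p i))).
      by apply: eq_bigr => i _; rewrite /xi; ring.
    by rewrite big_split/= -!mulr_sumr sumrB -mulr_sumr.
  rewrite p1 !mulr1 gerDl; have : 0 <= 2 * al * u by nra.
  by move: pm'; rewrite -/al => h1 h2; nra.
have -> : \sum_i p i * potential sigma (r - 1) (m' i) =
    (\sum_i p i * Num.max 0 (m' i - (1 - sigma) * (r - 1)) ^+ 2) / (r - 1) + 2 * ln (r - 1).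
  transitivity (\sum_i (p i * Num.max 0 (m' i - (1 - sigma) * (r - 1)) ^+ 2 / (r - 1)
      + p i * (2 * ln (r - 1)))).
    by apply: eq_bigr => i _; rewrite /potential mulrDr -[in RHS]mulrA.
  by rewrite big_split/= -!mulr_suml p1 mul1r.
rewrite /potential -/u.
have step1 : (\sum_i p i * Num.max 0 (m' i - (1 - sigma) * (r - 1)) ^+ 2) / (r - 1) <=
    (al ^+ 2 * u ^+ 2 + 1) / (r - 1).
  rewrite ler_pM2r ?invr_gt0//; apply: le_trans ss.
  by apply: ler_sum => i _; rewrite ler_wpM2l.
have step2 : (al ^+ 2 * u ^+ 2 + 1) / (r - 1) <= u ^+ 2 / r + 2 / r.
  have -> : (al ^+ 2 * u ^+ 2 + 1) / (r - 1) = al * (u ^+ 2 / r) + (r - 1)^-1.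
    by rewrite /al; field; rewrite !gt_eqF.
  apply: lerD; first by rewrite ler_piMl// divr_ge0 ?sqr_ge0// ltW.
  rewrite ler_pdivlMr// -ler_pdivlMl ?invr_gt0// invrK; lra.
have r1 : 1 < r by lra.
have := ln_pred_le r1; lra.
Qed.

(** If [r > 4 * k / sigma], then [m >= r - 2 * k] exceeds [(1 - sigma) * r] by at least
    [sigma * r / 2]; the quadratic term is at least [sigma ^+ 2 * r / 4], and the factor
    [4 / sigma ^+ 2] makes it dominate [r]. Otherwise the nonnegativity of the potential
    suffices. *)
Lemma potential_guard sigma r m k : 0 < sigma -> 1 <= r -> 0 <= k ->
  r - m <= 2 * k -> r - 4 / sigma ^+ 2 * potential sigma r m <= 4 * k / sigma.
Proof.
move=> s0 r1 k0 rm; have r0 : 0 < r by lra.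
have c0 : 0 <= 4 / sigma ^+ 2 by rewrite divr_ge0// sqr_ge0.
have l0 : 0 <= 2 * ln r by rewrite mulr_ge0// ln_ge0.
have Q0 : 0 <= Num.max 0 (m - (1 - sigma) * r) ^+ 2 / r.
  by rewrite divr_ge0 ?sqr_ge0// ltW.
have [rk|rk] := leP r (4 * k / sigma).
  rewrite /potential; nra.
have rs : 4 * k < r * sigma by rewrite -ltr_pdivrMr.
suff : r <= 4 / sigma ^+ 2 * (Num.max 0 (m - (1 - sigma) * r) ^+ 2 / r).
  have : 0 <= 4 * k / sigma by rewrite divr_ge0 ?mulr_ge0// ltW.
  rewrite /potential; nra.
rewrite mulrA ler_pdivlMr// mulrAC -[leLHS]mulr1 ler_pdivlMr ?exprn_gt0// mulr1.
have h : sigma * r / 2 <= Num.max 0 (m - (1 - sigma) * r).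
  rewrite le_max; apply/orP; right; lra.
have h0 : 0 <= sigma * r / 2 by rewrite divr_ge0// mulr_ge0 ?ltW.
have := h; rewrite -ler_sqr ?nnegrE// ?(le_trans h0 h)// => h2.
have -> : r * r * sigma ^+ 2 = 4 * (sigma * r / 2) ^+ 2 by field.
lra.
Qed.

Lemma potential_start sigma r m : m <= (1 - sigma) * r ->
  potential sigma r m = 2 * ln r.
Proof.
by move=> h; rewrite /potential max_l ?subr_le0// expr0n/= mul0r add0r.
Qed.

End Potential.

(** * Sample paths *)

Section Path.
Context (R : realType) (I : problem R).
Local Notation K := (narms I).
Local Notation B := (nblocks I).
Local Notation G := (groups I).
Implicit Types (a : nat -> 'I_K) (b : 'I_B) (t : nat) (L sigma : R).

Lemma pulls_recr a (D : {set 'I_K}) m t : (m <= t)%N ->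
  pulls a D m t.+1 = (pulls a D m t + (a t \in D))%N.
Proof. by move=> mt; rewrite /pulls big_nat_recr. Qed.

Lemma pulls_cat a (D : {set 'I_K}) m n t : (m <= n <= t)%N ->
  pulls a D m t = (pulls a D m n + pulls a D n t)%N.
Proof. by move=> /andP[mn nt]; rewrite /pulls (big_cat_nat mn nt). Qed.

Lemma eq_pulls a a' (D : {set 'I_K}) m n :
  (forall s, (s < n)%N -> a s = a' s) -> pulls a D m n = pulls a' D m n.
Proof. by move=> aa'; apply: eq_big_nat => s /andP[_ sn]; rewrite aa'. Qed.

Lemma sum_pulls1 a (D : {set 'I_K}) m n :
  (\sum_(i in D) pulls a [set i]%SET m n)%N = pulls a D m n.
Proof.
rewrite /pulls exchange_big/=; apply: eq_bigr => s _.
have [aD|aD] := boolP (a s \in D).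
  rewrite (bigD1 (a s))//= inE eqxx big1 ?addn0// => i /andP[_].
  by rewrite inE eq_sym => /negbTE ->.
rewrite big1// => i iD; rewrite inE; apply/eqP; rewrite eqb0.
by apply: contraNneq aD => ->.
Qed.

Lemma npulls_recr a i t : npulls a i t.+1 = (npulls a i t + (a t == i))%N.
Proof. by rewrite /npulls pulls_recr// inE. Qed.

Lemma remaining_recr b t : (t < bend b)%N ->
  remaining b t.+1 = remaining b t - 1.
Proof.
move=> tb; rewrite /remaining (_ : (bend b - t = (bend b - t.+1).+1)%N).
  by rewrite -natr1 addrK.
lia.
Qed.

Lemma deficit_recr b a t : (bstart b <= t)%N ->
  deficit b a t.+1 = dplus (deficit b a t) (a t) :> ({set 'I_K} -> R).
Proof.
move=> bt; apply/funext => g; rewrite /deficit /dplus pulls_recr// subnDA.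
set m := (flr b g - _)%N; have [me|/ltnW em] := leqP m (a t \in g).
  have -> : (m - (a t \in g) = 0)%N by lia.
  by rewrite max_r// subr_le0 ler_nat.
by rewrite natrB// max_l// subr_ge0 ler_nat.
Qed.

Lemma deficit_start b a : deficit b a (bstart b) = floor_demand b :> ({set 'I_K} -> R).
Proof.
by apply/funext => g; rewrite /deficit /pulls big_geq// subn0.
Qed.

Lemma remaining_start b : remaining b (bstart b) = (blen b)%:R.
Proof. by rewrite /remaining /bend addKn. Qed.

Lemma slack_recr b a t : (bstart b <= t < bend b)%N ->
  slack b a t - 1 <= slack b a t.+1.
Proof.
move=> /andP[bt tb]; rewrite /slack remaining_recr// deficit_recr//.
have := @mc_dplus_le R _ _ (groups_neq0 I) (deficit b a t) (a t) (fun g => ler0n _ _).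
lra.
Qed.

Section Block.
Context (b : 'I_B)
  (start_slack : forall a, 2 * K%:R < slack b a (bstart b)).

Lemma bstart_lt_bend : (bstart b < bend b)%N.
Proof.
rewrite /bend -addn1 leq_add2l lt0n; apply/eqP => b0.
have [i] : exists i : 'I_K, True by exists (Ordinal (narms_gt0 I)).
have := start_slack (fun=> i); rewrite /slack remaining_start b0.
have := mc_ge0 (groups_neq0 I) (deficit b (fun=> i) (bstart b)).
have : 0 <= K%:R :> R by []. lra.
Qed.

(** In the last round of the block the slack is at most [1 <= 2 * K], so the guard does fire. It
    cannot fire in the first round, and the slack loses at most 1 per round, whence its lower bound
    at the guard. *)
Lemma guard_fires_once a : exists t0, [/\ guard_fires b a t0, (bstart b < t0)%N,
  2 * K%:R - 1 < slack b a t0 &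
  forall t, preguard b a t <-> (bstart b <= t < t0)%N].
Proof.
pose Q t := (bstart b <= t < bend b)%N && (slack b a t <= 2 * K%:R).
have K1 : 1 <= K%:R :> R by rewrite ler1n narms_gt0.
have exQ : exists t, Q t.
  exists (bend b).-1; have := bstart_lt_bend => bb; apply/andP; split; first lia.
  rewrite /slack /remaining (_ : (bend b - _ = 1)%N); last lia.
  have := mc_ge0 (groups_neq0 I) (deficit b a (bend b).-1); lra.
case: (ex_minnP exQ) => t0 /andP[/andP[bt0 t0b] st0] mint0.
have before s : (bstart b <= s < t0)%N -> 2 * K%:R < slack b a s.
  move=> /andP[bs st]; rewrite ltNge; apply/negP => ss.
  have : (t0 <= s)%N by apply: mint0; rewrite /Q ss bs/= andbT; lia.
  lia.
have bt0' : (bstart b < t0)%N.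
  rewrite ltn_neqAle bt0 andbT; apply/eqP => bE.
  by move: st0; rewrite leNgt -bE start_slack.
exists t0; split => //.
- by split => //; rewrite bt0.
- have h : (bstart b <= t0.-1 < bend b)%N by lia.
  have h' : (bstart b <= t0.-1 < t0)%N by lia.
  have := slack_recr a h; have := before _ h'.
  rewrite (_ : t0.-1.+1 = t0); last lia.
  lra.
- move=> t; split.
    move=> [/andP[bt tb] h]; rewrite bt ltnNge; apply/negP => t0t.
    by have := h t0; rewrite bt0 t0t => /(_ isT); rewrite ltNge st0.
  move=> /andP[bt tt0]; split; first by lia.
  by move=> s bst; apply: before; lia.
Qed.

(** Rounding the minimum cover up adds at most [K] pulls, and the slack at the guard exceeds
    [2 * K - 1 >= K]: the committed pulls fit into the block, and they cover the deficits. *)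
Lemma floors_met L a x (g : {set 'I_K}) : g \in G -> guard_rule L a x ->
  (flr b g <= pulls a g (bstart b) (bend b))%N.
Proof.
move=> Gg rule; have [t0 [fires bt0 st0 _]] := guard_fires_once a.
have [/andP[_ t0b] _ _] := fires.
have [nE _] := rule b t0 fires.
set n := (\sum_i committed b a t0 i)%N in nE.
have [[w0 wcov] wtot] := min_coverP (groups_neq0 I) (deficit b a t0 : _ -> R).
set w := min_cover _ _ in w0 wcov wtot.
have cE i : (committed b a t0 i)%:R = (Num.ceil (w 0 i))%:~R :> R.
  rewrite /committed -/w -[in RHS](@gez0_abs (Num.ceil (w 0 i)))//.
  by rewrite ceil_ge0 (lt_le_trans (ltrN10 R)).
have K1 : 1 <= K%:R :> R by rewrite ler1n narms_gt0.
have nr : (t0 + n <= bend b)%N.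
  suff : n%:R <= (bend b - t0)%N%:R :> R by rewrite ler_nat; lia.
  apply: (@le_trans _ _ (mc G (deficit b a t0) + K%:R)); last first.
    by move: st0; rewrite /slack /remaining; lra.
  rewrite -wtot /total -[X in _ + X%:R](card_ord K) -sumr_const -big_split/=.
  rewrite natr_sum; apply: ler_sum => i _; rewrite cE.
  by have /andP[+ _] := ceil_itv (w 0 i); rewrite intrB => ?; lra.
have dn : (flr b g - pulls a g (bstart b) t0 <= pulls a g t0 (t0 + n))%N.
  rewrite -(ler_nat R) (le_trans (wcov g Gg))// -sum_pulls1 natr_sum.
  by apply: ler_sum => i _; rewrite nE cE ceil_ge.
rewrite (@pulls_cat _ _ _ t0); last by rewrite (ltnW bt0) (ltnW t0b).
rewrite [X in (_ + X)%N](@pulls_cat _ _ _ (t0 + n)); last by rewrite leq_addr.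
lia.
Qed.

(** The increment of [Psi] minus [4 / sigma ^+ 2] times the potential when arm [i] is pulled, plus
    the mean and the radius of [i]. The descent condition makes its average over the sampling law
    nonnegative. *)
Definition gain L sigma a t (i : 'I_K) : R :=
  let r := remaining b t in let d := deficit b a t in
  Psi G (@mean _ I) (r - 1) (dplus d i) - Psi G (@mean _ I) r d + mean i
  + radius L a t i - 4 / sigma ^+ 2 *
    (potential sigma (r - 1) (mc G (dplus d i)) - potential sigma r (mc G d)).

Lemma radius_ge0 L a t i : 0 <= radius L a t i.
Proof. by rewrite /radius le_min ler01 mulr_ge0// sqrtr_ge0. Qed.

(** The sum telescopes up to the guard. There [Psi] is at most the number of remaining rounds, so
    [potential_guard] leaves [4 * K / sigma]; at the block start only the logarithm of the potential
    survives. Means and radii are nonnegative, so their sum may be extended past the guard. *)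
Lemma sum_gain_le L sigma a : 0 < sigma < 1 ->
  (forall i : 'I_K, 0 <= mean i <= 1) ->
  mc G (floor_demand b) <= (1 - sigma) * (blen b)%:R ->
  \sum_(bstart b <= t < bend b) (if `[< preguard b a t >] then gain L sigma a t (a t) else 0)
  <= \sum_(bstart b <= t < bend b) (mean (a t) + radius L a t (a t))
     + 4 * K%:R / sigma + 8 / sigma ^+ 2 * ln (blen b)%:R
     - Psi G (@mean _ I) (blen b)%:R (floor_demand b).
Proof.
move=> /andP[s0 s1] mean01 mcb.
have [t0 [[/andP[_ t0b] st0 _] bt0 _ preE]] := guard_fires_once a.
rewrite (big_cat_nat (ltnW bt0) (ltnW t0b))/= [X in _ + X]big1_seq ?addr0; last first.
  move=> t /andP[_]; rewrite mem_index_iota => /andP[t0t _].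
  by rewrite asboolF// => /preE; lia.
pose y t := Psi G (@mean _ I) (remaining b t) (deficit b a t)
  - 4 / sigma ^+ 2 * potential sigma (remaining b t) (mc G (deficit b a t)).
have -> : \sum_(bstart b <= t < t0)
    (if `[< preguard b a t >] then gain L sigma a t (a t) else 0) =
    y t0 - y (bstart b) + \sum_(bstart b <= t < t0) (mean (a t) + radius L a t (a t)).
  rewrite -telescope_sumr ?(ltnW bt0)// -big_split/=.
  apply: eq_big_nat => t tt; rewrite asboolT; last exact/preE.
  rewrite /gain /y remaining_recr; last lia.
  rewrite deficit_recr; last lia.
  ring.
have pre_le : \sum_(bstart b <= t < t0) (mean (a t) + radius L a t (a t)) <=
    \sum_(bstart b <= t < bend b) (mean (a t) + radius L a t (a t)).
  rewrite [leRHS](big_cat_nat (ltnW bt0) (ltnW t0b))/= lerDl sumr_ge0// => t _.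
  by rewrite addr_ge0 ?radius_ge0//; case/andP: (mean01 (a t)).
have yt0 : y t0 <= 4 * K%:R / sigma.
  apply: le_trans (@potential_guard R sigma (remaining b t0)
      (mc G (deficit b a t0)) K%:R _ _ _ _) => //.
    by rewrite /y lerD2r Psi_le// ?ler0n.
  by rewrite ler1n; lia.
have yb : y (bstart b) = Psi G (@mean _ I) (blen b)%:R (floor_demand b)
    - 8 / sigma ^+ 2 * ln (blen b)%:R.
  rewrite /y remaining_start deficit_start potential_start//; ring.
rewrite yb; lra.
Qed.

End Block.

Lemma sum_blocks (F : nat -> R) :
  \sum_(0 <= t < horizon I) F t = \sum_(b < B) \sum_(bstart b <= t < bend b) F t.
Proof.
pose cs m := (\sum_(c < B | (c < m)%N) blen c)%N.
have csS (c : 'I_B) : cs c.+1 = (cs c + blen c)%N.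
  rewrite /cs (bigD1 c)//= addnC; congr (_ + _)%N; apply: eq_bigl => j.
  by rewrite ltnS ltn_neqAle andbC; congr (_ && _).
have hE : horizon I = cs B by rewrite /cs /horizon; apply: eq_bigl => c; rewrite ltn_ord.
suff h m : (m <= B)%N -> \sum_(0 <= t < cs m) F t =
    \sum_(c < B | (c < m)%N) \sum_(bstart c <= t < bend c) F t.
  by rewrite hE h//; apply: eq_bigl => c; rewrite ltn_ord.
elim: m => [_|m IH mB].
  have -> : cs 0%N = 0%N by rewrite /cs big_pred0.
  by rewrite big_geq// big_pred0.
pose c := Ordinal mB.
rewrite (bigD1 c)//= (csS c) (@big_cat_nat _ _ _ (cs c))//=; last exact: leq_addr.
rewrite IH; last exact: ltnW.
rewrite addrC; congr (_ + _); apply: eq_bigl => j.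
by rewrite ltnS ltn_neqAle andbC; congr (_ && _).
Qed.

Lemma bend_le_horizon b : (bend b <= horizon I)%N.
Proof.
rewrite /bend /bstart /horizon [leqRHS](bigID (fun c : 'I_B => (c < b)%N))/=.
by rewrite leq_add2l (bigD1 b) ?ltnn//= leq_addr.
Qed.

Lemma sum_npulls a n : (\sum_i npulls a i n)%N = n.
Proof.
transitivity (pulls a [set: 'I_K]%SET 0 n).
  by rewrite -sum_pulls1; apply: eq_bigl => i; rewrite finset.in_setT.
rewrite /pulls -[RHS]subn0 -[RHS]muln1 -sum_nat_const_nat.
by apply: eq_bigr => s _; rewrite finset.in_setT.
Qed.

(** Up to scaling, [1 / sqrt n <= 2 * (sqrt n - sqrt (n - 1))]. *)
Lemma sqrt_succ_sub (l : R) (n : nat) : 0 <= l -> (0 < n)%N ->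
  2 * Num.sqrt (l / n%:R) <= 4 * (Num.sqrt (l * n%:R) - Num.sqrt (l * n.-1%:R)).
Proof.
move=> l0 n0; have nR : 0 < n%:R :> R by rewrite ltr0n.
have -> : l / n%:R = (l * n%:R) / n%:R ^+ 2 by field; rewrite gt_eqF.
rewrite sqrtrM ?mulr_ge0// ?(ltW nR)// -[X in _ * Num.sqrt X]exprVn sqrtr_sqr.
rewrite ger0_norm ?invr_ge0 ?(ltW nR)//.
have -> : n.-1%:R = n%:R - 1 :> R by rewrite -subn1 natrB.
have h1 : 1 <= n%:R :> R by rewrite ler1n.
rewrite !(sqrtrM _ l0).
set u := Num.sqrt n%:R; set v := Num.sqrt (n%:R - 1).
have s0 := sqrtr_ge0 l.
have u2 : u ^+ 2 = n%:R by rewrite sqr_sqrtr// ltW.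
have v2 : v ^+ 2 = n%:R - 1 by rewrite sqr_sqrtr// subr_ge0.
have u0 : 0 < u by rewrite sqrtr_gt0.
have v0 : 0 <= v := sqrtr_ge0 _.
have uv : v <= u by rewrite ler_wsqrtr//; lra.
suff : u / n%:R <= 2 * (u - v) by move=> h; have := ler_wpM2l s0 h; lra.
rewrite ler_pdivrMr// -u2; have -> : 2 * (u - v) * u ^+ 2 = u * (2 * (u - v) * u) by ring.
rewrite -[leLHS]mulr1 ler_pM2l//; nra.
Qed.

Lemma sum_radius_le L a n : 0 <= L ->
  \sum_(0 <= t < n) radius L a t (a t) <=
    K%:R + 4 * Num.sqrt (2 * K%:R * n%:R * L).
Proof.
move=> L0; pose l := 2 * L; have l0 : 0 <= l by rewrite mulr_ge0.
(* [phi m] bounds the radii paid by the first [m] pulls of an arm: 1 for the first, by clipping,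
   then a telescoping sum. The predecessor appears because a pull uses only the observations made
   before it. *)
pose phi (m : nat) : R := if m == 0%N then 0 else 1 + 4 * Num.sqrt (l * m.-1%:R).
have step : \sum_(0 <= t < n) radius L a t (a t) <= \sum_i phi (npulls a i n).
  elim: n => [|n IH]; first by rewrite big_geq// sumr_ge0// => i _; rewrite /npulls /pulls big_geq.
  rewrite big_nat_recr//= (bigD1 (a n))//= addrC.
  rewrite (bigD1 (a n))//= in IH.
  have -> : \sum_(i | i != a n) phi (npulls a i n.+1) =
      \sum_(i | i != a n) phi (npulls a i n).
    by apply: eq_bigr => i /negbTE ia; rewrite npulls_recr eq_sym ia addn0.
  suff : radius L a n (a n) <= phi (npulls a (a n) n.+1) - phi (npulls a (a n) n) by lra.
  rewrite npulls_recr eqxx addn1 /phi /radius; set m := npulls a (a n) n.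
  rewrite ge_min; case: (posnP m) => [->|m0].
    by rewrite /= mulr0 sqrtr0 mulr0 addr0 subr0 lexx.
  rewrite gtn_eqF//= (maxn_idPl m0); apply/orP; right.
  by have := sqrt_succ_sub l0 m0; rewrite /l; lra.
apply: (le_trans step); apply: (@le_trans _ _ (\sum_i (1 + 4 * Num.sqrt (l * (npulls a i n)%:R)))).
  apply: ler_sum => i _; rewrite /phi; case: eqP => _.
    by rewrite addr_ge0// mulr_ge0// sqrtr_ge0.
  rewrite lerD2l ler_wpM2l// ler_wsqrtr// ler_wpM2l// ler_nat; exact: leq_pred.
rewrite big_split/= sumr_const card_ord lerD2l -mulr_sumr ler_wpM2l//.
have K0 : 0 < K%:R :> R by rewrite ltr0n narms_gt0.
set S := 2 * K%:R * n%:R * L; pose s := Num.sqrt S.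
have s2 : s ^+ 2 = S by rewrite sqr_sqrtr// /S !mulr_ge0.
(* The weight below divides by [s]; when [s] is 0, every summand vanishes. *)
have [n0|n0] := eqVneq s 0.
  rewrite -/s n0 big1// => i _; apply/eqP; rewrite sqrtr_eq0.
  have Nn : (npulls a i n <= n)%N by rewrite -[leqRHS](sum_npulls a) (bigD1 i)//= leq_addr.
  move: s2; rewrite n0 expr0n/= /S => /esym S0.
  have : K%:R * (l * n%:R) = 0 by rewrite /l -[RHS]S0; ring.
  move/eqP; rewrite mulf_eq0 (gt_eqF K0)/= => /eqP ln0.
  by rewrite -ln0 ler_wpM2l// ler_nat.
have s0 : 0 < s by rewrite lt_def n0 sqrtr_ge0.
(* AM-GM for each summand, with weight [s / K] *)
have amgm i : Num.sqrt (l * (npulls a i n)%:R) <=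
    (l * (npulls a i n)%:R * K%:R / s + s / K%:R) / 2.
  set x := l * _; have x0 : 0 <= x by rewrite mulr_ge0.
  have := sqr_ge0 (Num.sqrt x - s / K%:R); rewrite sqrrB sqr_sqrtr// => h.
  rewrite ler_pdivlMr//; have sK : 0 < s / K%:R by rewrite divr_gt0.
  have -> : x * K%:R / s = x / (s / K%:R) by field; rewrite !gt_eqF.
  rewrite -(ler_pM2r sK) mulrDl divfK ?gt_eqF//; nra.
apply: (le_trans (ler_sum _ (fun i _ => amgm i))).
rewrite -mulr_suml big_split/= sumr_const card_ord -!mulr_suml -mulr_sumr.
rewrite -natr_sum sum_npulls -[X in _ + X]mulr_natr.
have -> : l * n%:R * K%:R / s = s.
  apply: (@mulIf _ s); rewrite ?gt_eqF// divfK ?gt_eqF// -expr2 s2 /S /l; ring.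
by rewrite divfK ?gt_eqF// -/s; lra.
Qed.

End Path.

(** * Expected gain of a round *)

Section Descent.
Context (R : realType) (I : problem R).
Local Notation K := (narms I).
Local Notation G := (groups I).
Implicit Types (a : nat -> 'I_K) (b : 'I_(nblocks I)) (t : nat) (L sigma : R).

Lemma preguard_remaining b a t : preguard b a t ->
  2 < remaining b t /\ mc G (deficit b a t) <= remaining b t.
Proof.
move=> [/andP[bt tb] /(_ t)]; rewrite bt leqnn => /(_ isT); rewrite /slack.
have := mc_ge0 (groups_neq0 I) (deficit b a t).
have : 1 <= K%:R :> R by rewrite ler1n narms_gt0.
lra.
Qed.

Lemma sampling_probP L b a x t : preguard b a t ->
  (forall i, 0 <= sampling_prob L b a x t i) /\
  (\sum_i sampling_prob L b a x t i = 1 \/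
   forall i, sampling_prob L b a x t i = 0).
Proof.
move=> /preguard_remaining[r2 _].
have r0 : 0 < remaining b t :> R by apply: lt_trans r2.
rewrite /sampling_prob; set y := opt_plan _ _ _ _.
have [[[y0 _] ty]|y0] : plans G (remaining b t) (deficit b a t) y \/ y = 0.
- exact: opt_planP.
- split; first by move=> i; rewrite divr_ge0// ltW.
  by left; rewrite -mulr_suml [X in X / _]ty divff// gt_eqF.
- split=> [i|]; first by rewrite y0 mxE mul0r.
  by right => i; rewrite y0 mxE mul0r.
Qed.

Lemma sum_gain_ge0 L sigma b a x t : preguard b a t -> descent_at L b a x t ->
  0 <= \sum_i gain b L sigma a t i * sampling_prob L b a x t i.
Proof.
move=> pre [/= dmc dPsi]; have [r2 mcr] := preguard_remaining pre.
have [p0 [p1|pz]] := sampling_probP L x pre; last first.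
  by rewrite big1// => i _; rewrite pz mulr0.
set p := sampling_prob L b a x t in dmc dPsi p0 p1 *.
have pot := @potential_descent R K p (fun i => mc G (dplus (deficit b a t) i)) sigma
  (remaining b t) (mc G (deficit b a t)) p0 p1 r2 _ _ dmc.
have {}pot : \sum_i p i * potential sigma (remaining b t - 1) (mc G (dplus (deficit b a t) i))
    <= potential sigma (remaining b t) (mc G (deficit b a t)).
  apply: pot; first by rewrite mc_ge0 ?groups_neq0.
  move=> i; rewrite le_mc_dplus ?groups_neq0//= mc_dplus_le ?groups_neq0//.
have -> : \sum_i gain b L sigma a t i * p i =
    (\sum_i p i * (Psi G (@mean _ I) (remaining b t - 1) (dplus (deficit b a t) i) + mean i))
    + \sum_i p i * radius L a t i
    - Psi G (@mean _ I) (remaining b t) (deficit b a t) * \sum_i p i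
    - 4 / sigma ^+ 2 * ((\sum_i p i * potential sigma (remaining b t - 1)
        (mc G (dplus (deficit b a t) i)))
       - potential sigma (remaining b t) (mc G (deficit b a t)) * \sum_i p i).
  rewrite !mulr_sumr -sumrB mulr_sumr -big_split/= -!sumrB; apply: eq_bigr => i _.
  rewrite /gain; ring.
rewrite p1 !mulr1.
have c0 : 0 <= 4 / sigma ^+ 2 by rewrite divr_ge0// sqr_ge0.
have : 4 / sigma ^+ 2 * ((\sum_i p i * potential sigma (remaining b t - 1)
    (mc G (dplus (deficit b a t) i)))
       - potential sigma (remaining b t) (mc G (deficit b a t))) <= 0.
  by rewrite mulr_ge0_le0// subr_le0.
lra.
Qed.

Section Congruence.
Context (a a' : nat -> 'I_K) (t : nat) (aa' : forall s, (s < t)%N -> a s = a' s).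

Lemma eq_deficit b s : (s <= t)%N -> deficit b a s = deficit b a' s :> (_ -> R).
Proof.
move=> st; apply/funext => g; rewrite /deficit (@eq_pulls _ _ a a')// => u us.
by apply: aa'; apply: leq_trans us st.
Qed.

Lemma eq_radius L i : radius L a t i = radius L a' t i.
Proof. by rewrite /radius /npulls (@eq_pulls _ _ a a'). Qed.

Lemma eq_gain L sigma b i : gain b L sigma a t i = gain b L sigma a' t i.
Proof. by rewrite /gain eq_radius eq_deficit. Qed.

Lemma eq_preguard b : preguard b a t -> preguard b a' t.
Proof.
move=> [bt h]; split => // s /andP[bs st].
by rewrite /slack -eq_deficit//; apply: h; rewrite bs.
Qed.

End Congruence.
End Descent.

(** * Reduction to finite traces *)

Section Run.
Context (R : realType) (I : problem R) (d : measure_display)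
  (T : measurableType d) (P : probability T R).
Local Notation K := (narms I).
Local Notation H := (horizon I).
Context (X : reward_table I P) (A : nat -> T -> 'I_K) (L : R).
Context (mA : forall t i, measurable (A t @^-1` [set i])).

Definition trace (w : T) : {ffun 'I_H -> 'I_K} := [ffun s : 'I_H => A s w].

Definition extend (h : {ffun 'I_H -> 'I_K}) (s : nat) : 'I_K :=
  if insub s is Some k then h k else Ordinal (narms_gt0 I).

(** A prefix is encoded as a full trace padded with a default arm, so that traces can be partitioned
    by their prefix inside one finite type. *)
Definition truncate (t : nat) (h : {ffun 'I_H -> 'I_K}) : {ffun 'I_H -> 'I_K} :=
  [ffun s : 'I_H => if (s < t)%N then h s else Ordinal (narms_gt0 I)].

Lemma extend_ord h (s : 'I_H) : extend h s = h s.
Proof. by rewrite /extend valK. Qed.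

Lemma extend_trace w s : (s < H)%N -> extend (trace w) s = A s w.
Proof. by move=> sH; rewrite -[s]/(val (Ordinal sH)) extend_ord ffunE. Qed.

Lemma extend_truncate t h s : (t <= H)%N -> (s < t)%N ->
  extend (truncate t h) s = extend h s.
Proof.
move=> tH st; have sH := leq_trans st tH.
by rewrite -[s]/(val (Ordinal sH)) !extend_ord ffunE/= st.
Qed.

Lemma measurable_trace h : measurable (trace @^-1` [set h]).
Proof.
have -> : trace @^-1` [set h] = \bigcap_(s : 'I_H) (A s @^-1` [set h s]).
  apply/seteqP; split => w /=.
    by move=> <- s _ /=; rewrite ffunE.
  by move=> hw; apply/ffunP => s; rewrite ffunE; exact: hw.
exact: fin_bigcap_measurable.
Qed.

Let E := concentration L X.

(** The generating family of [past], named so that [past] becomes the sigma-algebra of a measurable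
    type and the library lemmas apply to it. *)
Definition past_generators t : set (set T) :=
  [set F | (exists i n V, measurable V /\ F = X i n @^-1` V) \/
           (exists s i, (s < t)%N /\ F = A s @^-1` [set i])].

Lemma past_concentration t : past X A t E.
Proof.
have := @measurable_uniform_deviation R _ (g_sigma_algebraType (past_generators t)) K (horizon I)
  (fun i n => X i n : T -> R) (@mean _ I) (fun n => Num.sqrt (2 * L / n%:R)).
apply => i n _ V mV; rewrite setTI; apply: sub_gen_smallest; left.
by exists i, n, V.
Qed.

Lemma past_truncate t g : past X A t [set w | truncate t (trace w) = g].
Proof.
pose T' := g_sigma_algebraType (past_generators t).
have -> : [set w | truncate t (trace w) = g] =
    \bigcap_(s : 'I_H) [set w | truncate t (trace w) s = g s].
  apply/seteqP; split => w /=; first by move=> <-.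
  by move=> h; apply/ffunP => s; exact: h.
suff : @measurable _ T' (\bigcap_(s : 'I_H) [set w | truncate t (trace w) s = g s]) by [].
apply: fin_bigcap_measurable => // s _.
have [st|ts] := ltnP s t.
  rewrite (_ : [set w | _] = A s @^-1` [set g s]); last first.
    by apply/seteqP; split => w /=; rewrite !ffunE st.
  by apply: sub_gen_smallest; right; exists s, (g s).
have [gs|gs] := eqVneq (Ordinal (narms_gt0 I)) (g s).
  rewrite (_ : [set w | _] = setT) //.
  by apply/seteqP; split => w //= _; rewrite ffunE ltnNge ts.
rewrite (_ : [set w | _] = set0) //.
by apply/seteqP; split => w //=; rewrite ffunE ltnNge ts/= => /eqP; rewrite (negbTE gs).
Qed.

Let q h : R := fine (P (E `&` trace @^-1` [set h])).

Context (mE : measurable E).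

Lemma sum_trace_probs (D : set T) (Q : pred {ffun 'I_H -> 'I_K}) :
  D `<=` E -> measurable D ->
  (forall w, E w -> D w <-> Q (trace w)) ->
  P D = (\sum_(h | Q h) q h)%:E.
Proof.
move=> DE mD DQ.
rewrite (@measure_fin_partition _ _ _ P _ D (fun h => trace @^-1` [set h]))//.
- rewrite -sumEFin [RHS]big_mkcond/=; apply: eq_bigr => h _.
  case: ifPn => Qh.
    rewrite /q fineK ?fin_num_measure//; last first.
      by apply: measurableI => //; exact: measurable_trace.
    congr (P _); apply/seteqP; split => w [Ew wh]; split => //; first exact: DE.
    by apply/(DQ _ Ew); rewrite wh.
  rewrite (_ : _ `&` _ = set0) ?measure0//.
  apply/seteqP; split => w //= [Dw wh]; move/negP: Qh; apply.
  by rewrite -wh; apply/(DQ _ (DE _ Dw)).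
- by move=> h; exact: measurable_trace.
- by move=> h h' _ _ [w [/= <- <-]].
- by move=> w _; exists (trace w).
Qed.

(** Traces are grouped by their prefix [g] before round [t], which determines [preguard] and,
    together with the next arm, the gain. The event [F] that [E] holds with prefix [g] lies in the
    past, so the sampling law gives the mass of each next arm as the integral over [F] of its
    probability, and [sum_gain_ge0] is integrated over [F]. *)
Lemma expected_gain_ge0 (sigma : R) (b : 'I_(nblocks I)) (t : nat) :
  pbdq_ucb L X A ->
  {ae P, forall w, E w -> forall t, preguard b (path A w) t ->
       descent_at L b (path A w) (table X w) t} ->
  (bstart b <= t < bend b)%N ->
  0 <= \sum_h q h * (if `[< preguard b (extend h) t >]
    then gain b L sigma (extend h) t (extend h t) else 0).
Proof.
move=> [_ law _] descent btb; have /andP[bt tb] := btb.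
have tH : (t < H)%N by apply: leq_trans tb (bend_le_horizon b).
rewrite (partition_big (truncate t) xpredT)//=; apply: sumr_ge0 => g _.
have agree h : truncate t h = g -> forall s, (s < t)%N -> extend h s = extend g s.
  by move=> <- s st; rewrite extend_truncate// ltnW.
have [pre|npre] := pselect (preguard b (extend g) t); last first.
  rewrite big1// => h /eqP hg; rewrite asboolF ?mulr0// => /eq_preguard-/(_ _ (agree h hg)).
  exact: npre.
pose F := E `&` [set w | truncate t (trace w) = g].
have pF : past X A t F.
  have mI : @measurable _ (g_sigma_algebraType (past_generators t)) F.
    by apply: measurableI; [exact: past_concentration|exact: past_truncate].
  exact: mI.
have agreeF w : F w -> forall s, (s < t)%N -> extend g s = path A w s.
  move=> [_ wg] s st; rewrite -(agree _ wg)// extend_trace//.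
  exact: ltn_trans st tH.
have preF w : F w -> preguard b (path A w) t.
  by move=> Fw; apply: eq_preguard pre; exact: agreeF.
have mF : measurable F.
  apply: measurableI => //.
  rewrite (_ : [set w | _] = \bigcup_(h in [set h | truncate t h = g]) (trace @^-1` [set h])).
    by apply: fin_bigcup_measurable => // h _; exact: measurable_trace.
  apply/seteqP; split => [w wg|w [h hg /= wh]]; first by exists (trace w).
  by rewrite wh.
(* The mass of [F] on which arm [i] is pulled at round [t]. *)
pose Q i := \sum_(h | (truncate t h == g) && (extend h t == i)) q h.
have PQ i : P (F `&` A t @^-1` [set i]) = (Q i)%:E.
  apply: sum_trace_probs; [by move=> w [[]]|exact: measurableI|].
  move=> w Ew; rewrite extend_trace//; split.
    by move=> [[_ /= ->] ->]; rewrite !eqxx.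
  by move=> /andP[/eqP wg /eqP <-].
have -> : \sum_(h | truncate t h == g) q h * (if `[< preguard b (extend h) t >]
    then gain b L sigma (extend h) t (extend h t) else 0) =
    \sum_i gain b L sigma (extend g) t i * Q i.
  rewrite (partition_big (fun h => extend h t) xpredT)//=; apply: eq_bigr => i _.
  rewrite /Q mulr_sumr; apply: eq_bigr => h /andP[/eqP hg /eqP <-].
  rewrite mulrC asboolT; first by rewrite (eq_gain (agree h hg)).
  by apply: eq_preguard pre => s st; rewrite (agree h hg).
have pp w : F w -> _ := fun Fw => sampling_probP L (table X w) (preF w Fw).
apply: (@ge0_sum_mul_integral _ _ _ P F K
   (fun i w => sampling_prob L b (path A w) (table X w) t i)) => //.
- by move=> i w /pp[].
- by move=> w /pp[_ [->|h]]; rewrite ?big1.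
- move=> i; rewrite -PQ; have := law b t i F btb pF => /=.
  have -> : F `&` [set w | preguard b (path A w) t] = F.
    by apply/seteqP; split => [w []//|w Fw]; split => //; exact: preF.
  by move=> ->.
- rewrite (@measure_fin_partition _ _ _ P _ F (fun i => A t @^-1` [set i]))//.
  + by rewrite -sumEFin; apply: eq_bigr => i _; exact: PQ.
  + by move=> i j _ _ [w [/= <- <-]].
  + by move=> w _; exists (A t w).
- apply: filterS descent => w dw Fw.
  under eq_bigr do rewrite (eq_gain (agreeF w Fw)).
  apply: sum_gain_ge0; first exact: preF.
  by apply: dw; [case: Fw|exact: preF].
Qed.

End Run.

(** * Regret *)

Section Regret.
Context (R : realType) (I : problem R) (eta sigma : R) (d : measure_display)
  (T : measurableType d) (P : probability T R) (X : reward_table I P)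
  (A : nat -> T -> 'I_(narms I)).
Local Notation K := (narms I).
Local Notation B := (nblocks I).
Local Notation H := (horizon I).
Local Notation L := (conf_level I eta).
Context (eta01 : 0 < eta < 1) (sigma01 : 0 < sigma < 1) (rX : rewards X)
  (alg : pbdq_ucb L X A) (descent : forall b, descent_condition eta sigma X A b)
  (long : forall b : 'I_B, 2 * K%:R < sigma * (blen b)%:R).

Lemma slack_start_gt (b : 'I_B) (a : nat -> 'I_K) : 2 * K%:R < slack b a (bstart b).
Proof.
rewrite /slack remaining_start deficit_start.
by have [+ _] := descent b; have := long b; lra.
Qed.

Lemma floors_satisfied : meets_floors A.
Proof.
move=> w b g Gg; have [_ _ rule] := alg.
exact: (floors_met (slack_start_gt b) Gg (rule w)).
Qed.

Lemma narms_ge1 : 1 <= K%:R :> R.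
Proof. by rewrite ler1n narms_gt0. Qed.

Lemma nblocks_ge1 : 1 <= B%:R :> R.
Proof. by rewrite ler1n nblocks_gt0. Qed.

Lemma blen_le_horizon (b : 'I_B) : (blen b <= H)%N.
Proof. by apply: leq_trans (bend_le_horizon b); rewrite leq_addl. Qed.

Lemma horizon_gt2 : 2 < H%:R :> R.
Proof.
pose b : 'I_B := Ordinal (nblocks_gt0 I).
apply: (@lt_le_trans _ _ (blen b)%:R); last by rewrite ler_nat blen_le_horizon.
have := long b; have := narms_ge1; have /andP[s0 s1] := sigma01.
have : 0 <= (blen b)%:R :> R by [].
nra.
Qed.

(** Lets [L] absorb the logarithm that the potential has at a block start. *)
Lemma ln_blen_le (b : 'I_B) : ln (blen b)%:R <= L.
Proof.
have /andP[e0 e1] := eta01; have K1 := narms_ge1; have H2 := horizon_gt2.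
have [b0|b0] := posnP (blen b).
  by have := long b; rewrite b0 mulr0; lra.
have bH : (blen b)%:R <= H%:R :> R by rewrite ler_nat blen_le_horizon.
have h : (blen b)%:R <= 2 * K%:R * H%:R / eta :> R.
  rewrite ler_pdivlMr//; have : 0 < (blen b)%:R :> R by rewrite ltr0n.
  nra.
rewrite /conf_level ler_ln ?posrE ?ltr0n//.
by apply: lt_le_trans h; rewrite ltr0n.
Qed.

Lemma conf_level_ge0 : 0 <= L.
Proof.
apply: le_trans (ln_blen_le (Ordinal (nblocks_gt0 I))); apply: ln_ge0.
rewrite ler1n lt0n; apply/eqP => b0.
by have := long (Ordinal (nblocks_gt0 I)); rewrite b0 mulr0; have := narms_ge1; lra.
Qed.

Lemma OPTfrac_le_horizon : OPTfrac I <= H%:R.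
Proof.
rewrite /OPTfrac /horizon natr_sum; apply: ler_sum => b _.
by apply: Psi_le => // i; exact: (mean_01 rX).
Qed.

Let q (h : {ffun 'I_H -> 'I_K}) : R :=
  fine (P (concentration L X `&` (@trace _ I _ T A) @^-1` [set h])).
Let V (a : nat -> 'I_K) : R := \sum_(0 <= t < H) mean (a t).

Lemma measurable_arm : forall t i, measurable (A t @^-1` [set i]).
Proof. by case: alg. Qed.

(** The value of a path is a nonnegative function of its trace, so discarding the complement of [E]
    can only lower the mean. *)
Lemma expected_value_ge :
  ((\sum_h q h * V (extend h))%:E <= expected_value P A)%E.
Proof.
have mtr h := @measurable_trace R I d T A measurable_arm h.
have V0 h : 0 <= V (extend h).
  by apply: sumr_ge0 => t _; case/andP: (mean_01 rX (extend h t)).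
have -> : expected_value P A =
    (\int[P]_w \sum_h (V (extend h))%:E * (\1_((@trace _ I _ T A) @^-1` [set h]) w)%:E)%E.
  rewrite /expected_value expectation.unlock; apply: eq_integral => w _.
  rewrite (bigD1 (trace A w))//= [X in _ = (_ + X)%E]big1.
    rewrite ?adde0 ?addr0 indicE mem_set// mule1; congr EFin.
    by apply: eq_big_nat => t /andP[_ tH]; rewrite extend_trace.
  by move=> h hw; rewrite indicE memNset ?mule0//= => /eqP; rewrite eq_sym (negbTE hw).
rewrite ge0_integral_sum//; last 2 first.
- move=> h; apply: emeasurable_funM => //; apply/measurable_EFinP.
  exact: measurable_indic.
- by move=> h w _; rewrite mule_ge0// lee_fin ?indicE.
rewrite -sumEFin; apply: lee_sum => h _.
rewrite ge0_integralZl//; last 2 first.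
- apply/measurable_EFinP; exact: measurable_indic.
- by rewrite lee_fin.
rewrite integral_indic// setIT mulrC EFinM; apply: lee_wpmul2l.
  by rewrite lee_fin.
have H0 : (0 < H)%N by rewrite -(ltr0n R); have := horizon_gt2; lra.
have [mE _] := concentration_prob rX eta01 H0.
rewrite /q fineK ?fin_num_measure//; last by apply: measurableI => //; exact: mE.
by apply: le_measure; rewrite ?inE//; apply: measurableI.
Qed.

Let Z : R := K%:R + 4 * Num.sqrt (2 * K%:R * H%:R * L)
  + 8 * B%:R * (L / sigma ^+ 2 + K%:R / sigma).

Lemma sum_gains_le (a : nat -> 'I_K) :
  \sum_(b < B) \sum_(bstart b <= t < bend b)
    (if `[< preguard b a t >] then gain b L sigma a t (a t) else 0) <=
  V a + Z - OPTfrac I.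
Proof.
have /andP[s0 s1] := sigma01.
apply: (@le_trans _ _ (\sum_(b < B)
  (\sum_(bstart b <= t < bend b) (mean (a t) + radius L a t (a t))
   + (4 * K%:R / sigma + 8 / sigma ^+ 2 * L)
   - Psi (groups I) (@mean _ I) (blen b)%:R (floor_demand b)))).
  apply: ler_sum => b _.
  apply: le_trans (@sum_gain_le R I b (slack_start_gt b) L sigma a sigma01 (mean_01 rX) _) _.
    by have [+ _] := descent b; lra.
  rewrite lerD2r -addrA lerD2l lerD2l ler_wpM2l ?ln_blen_le//.
  by rewrite divr_ge0// sqr_ge0.
rewrite sumrB big_split/= -sum_blocks big_split/= sumr_const card_ord -/(V a).
rewrite lerD2r -addrA lerD2l.
have -> : (4 * K%:R / sigma + 8 / sigma ^+ 2 * L) *+ B =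
    4 * (B%:R * (K%:R / sigma)) + 8 * B%:R * (L / sigma ^+ 2).
  by rewrite -mulr_natr; ring.
have Bk : 0 <= B%:R * (K%:R / sigma) by rewrite mulr_ge0// divr_ge0// ltW.
have := @sum_radius_le R I L a H conf_level_ge0.
rewrite /Z; lra.
Qed.

(** Let [m] be the total weight of the traces. Averaging [sum_gains_le] and using that expected
    gains are nonnegative gives [OPTfrac * m <= v + Z * m], where [v] is the weighted value. The
    rest of [OPTfrac], a fraction [1 - m <= 2 * eta], is at most [2 * eta * H]. *)
Lemma regret_bound :
  (expected_regret P A <=
    (K%:R + 4 * Num.sqrt (2 * K%:R * H%:R * L) + 2 * eta * H%:R
     + 8 * B%:R * (L / sigma ^+ 2 + K%:R / sigma))%:E)%E.
Proof.
have H0 : (0 < H)%N by rewrite -(ltr0n R); have := horizon_gt2; lra.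
have [mE PE] := concentration_prob rX eta01 H0.
set E := concentration _ _ in mE PE.
have sq : P E = (\sum_h q h)%:E.
  by apply: (sum_trace_probs measurable_arm mE (D := E) (Q := xpredT)).
have q0 h : 0 <= q h by rewrite /q fine_ge0.
have PE1 : 1 - \sum_h q h <= 2 * eta.
  by move: PE; rewrite probability_setC// sq -EFinB lee_fin.
have PE0 : 0 <= 1 - \sum_h q h.
  by rewrite subr_ge0 -lee_fin -sq probability_le1.
have Z0 : 0 <= Z.
  have /andP[s0 _] := sigma01; have L0 := conf_level_ge0.
  by rewrite /Z !addr_ge0 ?mulr_ge0 ?sqrtr_ge0 ?addr_ge0 ?divr_ge0 ?sqr_ge0// ltW.
have key : 0 <= \sum_h q h * (V (extend h) + Z - OPTfrac I).
  apply: (@le_trans _ _ (\sum_h q h * \sum_(b < B) \sum_(bstart b <= t < bend b)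
    (if `[< preguard b (extend h) t >]
     then gain b L sigma (extend h) t (extend h t) else 0))); last first.
    by apply: ler_sum => h _; rewrite ler_wpM2l// sum_gains_le.
  under eq_bigr do rewrite mulr_sumr; rewrite exchange_big/= sumr_ge0// => b _.
  under eq_bigr do rewrite mulr_sumr; rewrite exchange_big/= big_nat_cond sumr_ge0// => t.
  rewrite andbT => bt; apply: expected_gain_ge0 => //; first exact: measurable_arm.
  by have [_] := descent b.
have -> : expected_regret P A = ((OPTfrac I)%:E - expected_value P A)%E by [].
apply: (@le_trans _ _ ((OPTfrac I)%:E - (\sum_h q h * V (extend h))%:E)%E).
  by rewrite leeB// expected_value_ge.
rewrite -EFinB lee_fin.
have : \sum_h q h * (V (extend h) + Z - OPTfrac I) =
    \sum_h q h * V (extend h) + (Z - OPTfrac I) * \sum_h q h.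
  by rewrite mulr_sumr -big_split/=; apply: eq_bigr => h _; ring.
move: key => /[swap] ->.
have := OPTfrac_le_horizon; have : 0 <= H%:R :> R by [].
move: (\sum_h _) (\sum_h _) PE1 PE0 Z0 => v m; rewrite /Z; nra.
Qed.

(** With [l = ln (K * H) >= 1 / 2], the choice of [eta] gives [L = ln (2 * K * H ^+ 2) <= 3 * l],
    and [2 * L <= (6 * l) ^+ 2] yields [24 = 4 * 6]. The additive [K] and [2 * eta * H = 2] are
    absorbed by the block term: [2 <= 4 * l * u] raises [8 * 3 = 24] to 28, and
    [K + 8 * v <= 18 * l * v]. *)
Lemma regret_bound_inv : eta = H%:R^-1 ->
  (expected_regret P A <=
    (24 * ln (K%:R * H%:R) ^+ 1 * Num.sqrt (K%:R * H%:R)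
     + 28 * ln (K%:R * H%:R) ^+ 1
         * (B%:R * (1 / sigma ^+ 2 + K%:R / sigma)))%:E)%E.
Proof.
move=> etaE; apply: (le_trans regret_bound); rewrite lee_fin !expr1.
have K1 := narms_ge1; have B1 := nblocks_ge1; have H2 := horizon_gt2.
have /andP[s0 s1] := sigma01.
have H0 : 0 < H%:R :> R by lra.
set k : R := K%:R in K1 *; set h : R := H%:R in H2 H0 etaE *.
set l := ln (k * h).
have kh2 : 2 <= k * h by nra.
have kh0 : 0 < k * h by lra.
have l2 : 2^-1 <= l.
  by rewrite -ler_expR lnK ?posrE// (le_trans (expR_half_le2 R)).
have L3 : L <= 3 * l.
  rewrite /conf_level -/k -/h etaE invrK /l (mulr_natl (ln (k * h)) 3) -lnXn//
      ler_ln ?posrE ?exprn_gt0//; last first.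
    by rewrite !mulr_gt0//; lra.
  have k0 : 0 <= k by lra.
  have -> : (k * h) ^+ 3 = (k * h) * (k * h) * (k * h) by ring.
  have -> : 2 * k * h * h = 2 * (k * h) * h by ring.
  have hkh : h <= k * h by rewrite ler_peMl// ltW.
  apply: (@le_trans _ _ (2 * (k * h) * (k * h))); first by rewrite ler_wpM2l//; lra.
  by rewrite -mulrA (mulrC 2) ler_wpM2l//; nra.
have L0 := conf_level_ge0.
have sq : Num.sqrt (2 * k * h * L) <= 6 * l * Num.sqrt (k * h).
  have l6 : 0 <= 6 * l by lra.
  rewrite -[6 * l]ger0_norm// -sqrtr_sqr -sqrtrM ?sqr_ge0//; apply: ler_wsqrtr.
  have -> : 2 * k * h * L = 2 * L * (k * h) by ring.
  by rewrite ler_wpM2r ?(ltW kh0)//; nra.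
have eh : 2 * eta * h = 2 by rewrite etaE mulfVK// gt_eqF.
rewrite eh.
set x := sigma^-1.
have x1 : 1 <= x by rewrite -invr1 lef_pV2 ?posrE ?ltW.
have -> : k / sigma = k * x by [].
have -> : L / sigma ^+ 2 = L * x ^+ 2 by rewrite /x exprVn.
have -> : 1 / sigma ^+ 2 = x ^+ 2 by rewrite /x exprVn mul1r.
set b : R := B%:R in B1 *.
have x21 : 1 <= x ^+ 2 by rewrite exprn_ege1.
have b0 : 0 <= b by lra.
have bx : 1 <= b * x ^+ 2 by nra.
have kx : k <= k * x by rewrite ler_peMr//; lra.
have bkx : k <= b * (k * x) by apply: (le_trans kx); rewrite ler_peMl//; lra.
have e1 : 8 * b * (L * x ^+ 2 + k * x) = 8 * (L * (b * x ^+ 2)) + 8 * (b * (k * x)) by ring.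
have e2 : 28 * l * (b * (x ^+ 2 + k * x)) =
    28 * (l * (b * x ^+ 2)) + 28 * (l * (b * (k * x))) by ring.
rewrite e1 e2; set u := b * x ^+ 2 in bx *; set v := b * (k * x) in bkx *.
have v0 : 0 <= v by lra.
have p1 : L * u <= 3 * (l * u) by rewrite mulrA ler_wpM2r//; lra.
have p2 : v <= 2 * (l * v) by rewrite mulrA ler_peMl//; lra.
have p3 : 1 <= 2 * (l * u) by rewrite mulrA; nra.
lra.
Qed.

End Regret.

Theorem theorem29 (R : realType) :
  exists (C C1 C2 : R) (k1 k2 : nat),
  forall (I : problem R) (eta sigma : R) (d : measure_display)
    (T : measurableType d) (P : probability T R)
    (X : reward_table I P) (A : nat -> T -> 'I_(narms I)),
  0 < eta < 1 -> 0 < sigma < 1 ->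
  rewards X ->
  pbdq_ucb (conf_level I eta) X A ->
  (forall b, descent_condition eta sigma X A b) ->
  (forall b : 'I_(nblocks I), 2 * (narms I)%:R < sigma * (blen b)%:R) ->
  let K : R := (narms I)%:R in
  let B : R := (nblocks I)%:R in
  let H : R := (horizon I)%:R in
  let L : R := conf_level I eta in
  [/\ meets_floors A,
      (expected_regret P A <=
        (K + 4 * Num.sqrt (2 * K * H * L) + 2 * eta * H
         + C * B * (L / sigma ^+ 2 + K / sigma))%:E)%E &
      eta = H^-1 ->
      (expected_regret P A <=
        (C1 * ln (K * H) ^+ k1 * Num.sqrt (K * H)
         + C2 * ln (K * H) ^+ k2 * (B * (1 / sigma ^+ 2 + K / sigma)))%:E)%E].
Proof.
exists 8, 24, 28, 1%N, 1%N => I eta sigma d T P X A e01 s01 rX alg desc long /=.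
split.
- exact: floors_satisfied alg desc long.
- exact: regret_bound e01 s01 rX alg desc long.
- exact: regret_bound_inv e01 s01 rX alg desc long.
Qed.
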